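(* Let $X=M$ or $X=\partial M$, let $\alpha\in(0,1)$, $T>0$, let $w\in L^1(0,T;L^2(X))$, $h\in L^2(X)$, and fix $\epsilon\in(0,T)$. Then the condition $$w(t,x)=D_t^\alpha(w-h(x))(t,x)=0,\quad (t,x)\in(T-\epsilon,T)\times X,$$ implies that $$w(t,x)=h(x)=0,\quad (t,x)\in(0,T)\times X.$$
   Context: $(M,g)$ is a compact connected smooth Riemannian manifold with smooth boundary $\partial M$. For $\gamma\in(0,1]$ and $w\in L^1(0,T;L^2(X))$, the fractional integral is $$I_t^\gamma w(t,x)=\int_0^t\frac{(t-s)^{\gamma-1}}{\Gamma(\gamma)}w(s,x)\,ds,$$ and the Riemann-Liouville derivative of order $\alpha$ is $D_t^\alpha w=\partial_tI_t^{1-\alpha}w$. Since $I_t^{1-\alpha}w\in L^1(0,T;L^2(X))$, $D_t^\alpha w$ is understood as an element of $\mathcal D'(0,T;L^2(X))$ (distributions in $t\in(0,T)$ with values in $L^2(X)$), and its vanishing on $(T-\epsilon,T)\times X$ is in the sense of distributions. The function $h$ is regarded as a function of $(t,x)$ constant in $t$. *)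

(* Defs.v *)
From HB Require Import structures.
From mathcomp Require Import all_boot all_order all_algebra.
From mathcomp Require Import all_classical all_reals all_analysis.
Set Implicit Arguments.
Unset Strict Implicit.
Unset Printing Implicit Defensive.
Import Order.TTheory GRing.Theory Num.Theory.
Import numFieldNormedType.Exports.
Local Open Scope classical_set_scope.
Local Open Scope ring_scope.

Section calculus.
Context {R : realType}.

Fixpoint Ck (k n : nat) (O : set 'rV[R]_n) (f : 'rV[R]_n -> R) : Prop :=
  (forall x, O x -> {for x, continuous f}) /\
  match k with
  | 0 => True
  | k'.+1 => forall i : 'I_n,
      (forall x, O x -> derivable f x (delta_mx 0 i)) /\
      Ck k' O ('D_(delta_mx 0 i) f)
  end.

Definition smooth n (O : set 'rV[R]_n) (f : 'rV[R]_n -> R) : Prop :=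
  forall k, Ck k O f.

Definition half_space n : set 'rV[R]_n :=
  [set v | forall k : 'I_n, val k = 0%N -> 0 <= v 0 k].

(* Lebesgue integral over R^n of a nonnegative Borel function, as an iterated
   integral (Tonelli); for n = 0 it is evaluation at the only point. *)
Fixpoint lebesgue_int (n : nat) : ('rV[R]_n -> \bar R) -> \bar R :=
  match n with
  | 0 => fun f => f 0
  | m.+1 => fun f =>
      (\int[lebesgue_measure]_(x in [set: R])
        lebesgue_int (fun y : 'rV[R]_m => f (row_mx (x%:M : 'M[R]_1) y)))%E
  end.

(* Lebesgue integral over {0} x R^(n-1), the boundary of [half_space n]. *)
Definition lebesgue_int_boundary (n : nat) :
    ('rV[R]_n -> \bar R) -> \bar R :=
  match n with
  | 0 => fun=> 0%E
  | m.+1 => fun f =>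
      lebesgue_int (fun y : 'rV[R]_m => f (row_mx (0 : 'M[R]_1) y))
  end.

Definition tangential_block (n : nat) : 'M[R]_n -> 'M[R]_n.-1 :=
  match n with
  | 0 => id
  | m.+1 => fun G => drsubmx (G : 'M[R]_(1 + m))
  end.

End calculus.

(* [chart_homeo] says that each chart is a homeomorphism of its domain onto a
   relatively open subset of the half-space.  [chart_smooth] is smoothness of
   the transition maps, in the sense of local smooth extension to open subsets
   of R^n, as is usual at boundary points. *)
Record smooth_manifold (R : realType) (n : nat) (M : topologicalType) := {
  chart_index : Type ;
  dom : chart_index -> set M ;
  chart : chart_index -> M -> 'rV[R]_n ;
  param : chart_index -> 'rV[R]_n -> M ;
  manifold_hausdorff : hausdorff_space M ;
  manifold_second_countable : @second_countable M ;
  dom_open : forall i, open (dom i) ;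
  dom_cover : forall p, exists i, dom i p ;
  chartK : forall i p, dom i p -> param i (chart i p) = p ;
  chart_homeo : forall i (U : set M), U `<=` dom i ->
    (open U <->
     exists2 W, open W & chart i @` U = W `&` @half_space R n) ;
  chart_smooth : forall i j p, dom i p -> dom j p ->
    exists (O : set 'rV[R]_n) (F : 'rV[R]_n -> 'rV[R]_n),
      [/\ open O, O (chart i p), forall k, smooth O (fun x => F x 0 k) &
          forall q, dom i q -> dom j q -> O (chart i q) ->
            F (chart i q) = chart j q]
}.

(* [gram i v] is the Gram matrix of the metric in the coordinates of the chart
   [i], at the point of coordinates [v]; only its values on the image of the
   chart matter.  With row vectors the differential of F at x is v |-> v *m 'J F x,
   so [gram_change] is the tensoriality of the metric.  At a boundary point,
   'J F does not depend on the smooth extension F. *)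
Record riemannian_metric (R : realType) (n : nat) (M : topologicalType)
    (SM : smooth_manifold R n M) := {
  gram : chart_index SM -> 'rV[R]_n -> 'M[R]_n ;
  gram_smooth : forall i p, dom i p -> forall a b,
    exists (O : set 'rV[R]_n) (G : 'rV[R]_n -> R),
      [/\ open O, O (chart i p), smooth O G &
          forall q, dom i q -> O (chart i q) ->
            G (chart i q) = gram i (chart i q) a b] ;
  gram_sym : forall i p, dom i p ->
    (gram i (chart i p))^T = gram i (chart i p) ;
  gram_posdef : forall i p, dom i p -> forall u : 'rV[R]_n, u != 0 ->
    0 < (u *m gram i (chart i p) *m u^T) 0 0 ;
  gram_change : forall i j (O : set 'rV[R]_n) (F : 'rV[R]_n -> 'rV[R]_n),
    open O -> (forall k, smooth O (fun x => F x 0 k)) ->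
    (forall q, dom i q -> dom j q -> O (chart i q) ->
      F (chart i q) = chart j q) ->
    forall p, dom i p -> dom j p -> O (chart i p) ->
      gram i (chart i p) =
        'J F (chart i p) *m gram j (chart j p) *m ('J F (chart i p))^T
}.

Definition manifold_boundary (R : realType) (n : nat) (M : topologicalType)
    (SM : smooth_manifold R n M) : set M :=
  [set p | exists (i : chart_index SM) (k : 'I_n),
     [/\ dom i p, val k = 0%N & chart i p 0 k = 0]].

Notation borel_space M := (g_sigma_algebraType (@open M)).

Definition is_riemannian_volume (R : realType) (n : nat)
    (M : ptopologicalType) (SM : smooth_manifold R n M)
    (g : riemannian_metric SM)
    (mu : {measure set (borel_space M) -> \bar R}) : Prop :=
  forall (i : chart_index SM) (A : set (borel_space M)), measurable A ->
    A `<=` dom i ->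
    mu A = lebesgue_int (fun v =>
      (\1_(chart i @` A) v * Num.sqrt (\det (gram g i v)))%:E).

(* The volume measure of the boundary with its induced metric, as a Borel
   measure on M concentrated on the boundary; its L^2 space is that of the
   boundary.  In dimension n = 1 it is the counting measure of the boundary. *)
Definition is_boundary_volume (R : realType) (n : nat)
    (M : ptopologicalType) (SM : smooth_manifold R n M)
    (g : riemannian_metric SM)
    (mu : {measure set (borel_space M) -> \bar R}) : Prop :=
  forall (i : chart_index SM) (A : set (borel_space M)), measurable A ->
    A `<=` dom i ->
    mu A = lebesgue_int_boundary (fun v =>
      (\1_(chart i @` (A `&` manifold_boundary SM)) v *
       Num.sqrt (\det (tangential_block (gram g i v))))%:E).

(* Elements of L^2 are represented by square-integrable functions; equality in
   L^2 is equality almost everywhere. *)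
Notation L2 mu := (LfunType mu (lee1n 2)).

Section bochner.
Context {d : measure_display} {X : measurableType d} {R : realType}.
Variable mu : {measure set X -> \bar R}.
Local Notation lambda := (@lebesgue_measure R).

Definition L2_norm (f : L2 mu) : \bar R := 'N[mu]_2%:E[EFin \o f]%E.

Definition L2_eq0 (f : L2 mu) : Prop := (f : X -> R) = cst 0 %[ae mu].

Record simple_fun := {
  sf_size : nat ;
  sf_set : 'I_sf_size -> set R ;
  sf_val : 'I_sf_size -> L2 mu ;
  sf_measurable : forall i, measurable (sf_set i) ;
  sf_finite : forall i, (lambda (sf_set i) < +oo)%E
}.

Definition sf_eval (s : simple_fun) (t : R) : L2 mu :=
  \sum_(i < sf_size s) \1_(sf_set i) t *: sf_val i.

Definition sf_integral (D : set R) (s : simple_fun) : L2 mu :=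
  \sum_(i < sf_size s) fine (lambda (D `&` sf_set i)) *: sf_val i.

Definition strongly_measurable (D : set R) (f : R -> L2 mu) : Prop :=
  exists s : nat -> simple_fun, {ae lambda, forall t, D t ->
    (fun k => L2_norm (sf_eval (s k) t - f t)) @ \oo --> 0%E}.

Definition bochner_integrable (D : set R) (f : R -> L2 mu) : Prop :=
  strongly_measurable D f /\ (\int[lambda]_(t in D) L2_norm (f t) < +oo)%E.

Definition is_bochner_integral (D : set R) (f : R -> L2 mu) (v : L2 mu) :
    Prop :=
  strongly_measurable D f /\
  exists s : nat -> simple_fun,
    (fun k => \int[lambda]_(t in D) L2_norm (sf_eval (s k) t - f t)%R)%E
      @ \oo --> 0%E /\
    (fun k => L2_norm (sf_integral D (s k) - v)) @ \oo --> 0%E.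

(* A representative of the Bochner integral, and 0 if there is no integral. *)
Definition bochner_integral (D : set R) (f : R -> L2 mu) : L2 mu :=
  xget 0 [set v | is_bochner_integral D f v].

Definition Gamma (x : R) : R :=
  (\int[lambda]_(t in `]0%R, +oo[) (t `^ (x - 1) * expR (- t)))%R.

(* The integral exists for almost every t when f is integrable. *)
Definition frac_integral (gamma : R) (f : R -> L2 mu) (t : R) : L2 mu :=
  bochner_integral `]0, t[
    (fun s => ((t - s) `^ (gamma - 1) / Gamma gamma) *: f s).

Definition test_function (a b : R) (phi : R -> R) : Prop :=
  (forall k t, derivable (derive1n k phi) t 1) /\
  exists a' b', [/\ a < a', b' < b & forall t, phi t != 0 -> a' <= t <= b'].

(* The L^2-valued distribution on ]0, T[ that is the time derivative of
   [frac_integral (1 - alpha) f], applied to the test function phi. *)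
Definition RL_derivative (T alpha : R) (f : R -> L2 mu) (phi : R -> R) :
    L2 mu :=
  - bochner_integral `]0, T[
      (fun t => derive1 phi t *: frac_integral (1 - alpha) f t).

Definition distribution_vanishes_on (a b : R) (u : (R -> R) -> L2 mu) : Prop :=
  forall phi, test_function a b phi -> L2_eq0 (u phi).

Definition vanishes_on (a b : R) (f : R -> L2 mu) : Prop :=
  {ae lambda, forall t, a < t < b -> L2_eq0 (f t)}.

End bochner.

(* Main.v *)
Require Import Defs.
From mathcomp Require Import all_boot all_order all_algebra.
From mathcomp Require Import all_classical all_reals all_analysis.
From mathcomp Require Import measurable_realfun.
From mathcomp Require Import ring lra.
Import Order.TTheory GRing.Theory Num.Theory.
Import numFieldNormedType.Exports.
Local Open Scope classical_set_scope.
Local Open Scope ring_scope.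


(** The fractional derivative of w - h on (a, T), with a = T - eps, sees the
whole past of w, and it is analytic in t there because w vanishes on (a, T).
Knowing it to be zero therefore gives infinitely many equations on the past,
and these determine it.

Fix psi in L^2 and put u = <w, psi>, c = <h, psi>.  For a < t < T the pairing
of the fractional integral F(t) of w - h with psi is
  1 / Gamma(1 - alpha) *
    (int_0^a (t - s)^(-alpha) u(s) ds - c t^(1 - alpha) / (1 - alpha))
([frac_integral_pairing]), a multiple of M_(alpha-1)(t), where
  M_b(t) = b int_0^a (t - s)^(-b-1) u(s) ds + c t^(-b)
([memory]).  For b > 0 this is b int (t - s)^(-b-1) U(s) ds, where U is u on
(0, a) and the constant c on the negative half-line: h plays the role of the
history before time 0.  Differentiation in t gives M_b' = - b M_(b+1).

Bump functions turn the distributional equation into M_alpha = 0 on (a, T)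
([fundamental_lemma], [memory_vanishes]); differentiating again, M_(alpha+j) = 0
on (a, T) for all j.  At one time t0, in the variable Y = t0 / (t0 - s), which
maps the past onto (0, B) with s = 0 at Y = 1, these equations say that all
the moments of one integrable function on (0, B) vanish.  Polynomials that
converge boundedly to step functions ([step_poly_cvg]) then give that its
integral over (0, x) vanishes for all x < B.  Taking x = 1 gives c = 0, and
then, by differentiation in x, u = 0 almost everywhere ([memory_moments]).

The choice psi = h gives h = 0.  For w the exceptional null set depends on psi,
but countably many psi suffice: the values of the simple functions that
approximate w ([vanishing]).

Bochner integrals are total, with value 0 where there is no integral, so both
that of the fractional integral and that in the definition of the distribution
must be shown to exist before they can be paired with psi.  Existence is
obtained from the completeness of L^2 ([cauchy_L2_cvg]) by truncation of the
approximating simple functions ([ex_bochner_integral]).  For the second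
integral the strong measurability of F comes from its Lipschitz continuity on
the compact parts of (a, T) ([frac_integral_lipschitz], [smeas_lipschitz]). *)


(** * The inner product of L^2 *)

Section L2_inner_product.
Context {d : measure_display} {X : measurableType d} {R : realType}.
Variable mu : {measure set X -> \bar R}.
Implicit Types u v w : L2 mu.

(** A semi-inner product: elements of [L2 mu] are functions, and those that vanish
almost everywhere are not identified with 0. *)
Definition ip u v : R := \int[mu]_x (u x * v x).

(** Real-valued version of the L^2 norm, which is finite on [L2 mu]. *)
Definition nm u : R := fine (L2_norm u).

Lemma L2_normE u : L2_norm u = (nm u)%:E.
Proof. by rewrite /nm /L2_norm finite_norm_fine. Qed.

Lemma nm_ge0 u : 0 <= nm u.
Proof. by rewrite /nm fine_ge0// Lnorm_ge0. Qed.

Lemma integrable_ip u v : mu.-integrable setT (fun x => (u x * v x)%:E).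
Proof.
have := Lfun2_mul_Lfun1 (LfunP u) (LfunP v).
by move=> /Lfun1_integrable.
Qed.

Lemma ipC u v : ip u v = ip v u.
Proof. by apply: eq_Rintegral => x _; rewrite mulrC. Qed.

Lemma ipDl u v w : ip (u + v) w = ip u w + ip v w.
Proof.
rewrite /ip -RintegralD//; [|exact: integrable_ip..].
by apply: eq_Rintegral => x _; rewrite -mulrDl.
Qed.

Lemma ipZl a u w : ip (a *: u) w = a * ip u w.
Proof.
rewrite /ip -RintegralZl//; last exact: integrable_ip.
by apply: eq_Rintegral => x _; rewrite mulrA.
Qed.

Lemma ipNl u w : ip (- u) w = - ip u w.
Proof. by rewrite -scaleN1r ipZl mulN1r. Qed.

Lemma ipBl u v w : ip (u - v) w = ip u w - ip v w.
Proof. by rewrite ipDl ipNl. Qed.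

Lemma ip0l w : ip 0 w = 0.
Proof. by rewrite -[0](scale0r 0) ipZl mul0r. Qed.

Lemma ip_suml (I : Type) (r : seq I) (f : I -> L2 mu) w :
  ip (\sum_(i <- r) f i) w = \sum_(i <- r) ip (f i) w.
Proof.
elim: r => [|i r IHr]; first by rewrite !big_nil ip0l.
by rewrite !big_cons ipDl IHr.
Qed.

Lemma nm_sqr u : nm u ^+ 2 = ip u u.
Proof.
apply: EFin_inj; rewrite -powR_mulrn ?nm_ge0// -poweR_EFin -L2_normE.
rewrite /L2_norm powR_Lnorm// /ip /Rintegral fineK; last first.
  by apply: integrable_fin_num => //; exact: integrable_ip.
apply: eq_integral => x _; congr EFin.
by rewrite powR_mulrn// real_normK ?num_real// expr2.
Qed.

(** Hoelder's inequality for the exponents 2 and 2. *)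
Lemma ip_le u v : `|ip u v| <= nm u * nm v.
Proof.
rewrite /ip (le_trans (le_normr_Rintegral _ (integrable_ip u v)))//.
rewrite -lee_fin EFinM -!L2_normE /L2_norm.
have -> : (\int[mu]_x `|u x * v x|)%:E = 'N[mu]_1[EFin \o (u \* v)%R]%E.
  rewrite Lnorm1 /Rintegral fineK//.
  by apply: integrable_fin_num => //; exact: (integrable_abse (integrable_ip u v)).
by apply: hoelder => //; rewrite [RHS]splitr !div1r.
Qed.

Lemma nmD u v : nm (u + v) <= nm u + nm v.
Proof. exact: ler_LnormD. Qed.

Lemma nmZ a u : nm (a *: u) = `|a| * nm u.
Proof. by apply: EFin_inj; rewrite EFinM -!L2_normE; exact: LnormZ. Qed.

Lemma nmN u : nm (- u) = nm u.
Proof. by rewrite -scaleN1r nmZ normrN1 mul1r. Qed.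

Lemma nmBC u v : nm (u - v) = nm (v - u).
Proof. by rewrite -nmN opprB. Qed.

Lemma nm0 : nm 0 = 0.
Proof. by rewrite -[0](scale0r 0) nmZ normr0 mul0r. Qed.

Lemma nmB u v : nm (u - v) <= nm u + nm v.
Proof. by rewrite (le_trans (nmD _ _))// nmN. Qed.

Lemma nm_trans v u w : nm (u - w) <= nm (u - v) + nm (v - w).
Proof. by rewrite -[u - w](subrKA v); exact: nmD. Qed.

Lemma ler_nmB u v : `|nm u - nm v| <= nm (u - v).
Proof.
rewrite ler_norml; apply/andP; split.
  by rewrite lerNl opprB lerBlDr nmBC -{1}(subrK u v) nmD.
by rewrite lerBlDr -{1}(subrK v u) nmD.
Qed.

Lemma L2_eq0P u : L2_eq0 u <-> nm u = 0.
Proof.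
split; last by move=> /fine_Lnormr_eq0.
move=> u0; apply/eqP; rewrite -sqrf_eq0 nm_sqr; apply/eqP.
rewrite /ip /Rintegral (ae_eq_integral (cst 0)%E) ?integral0//.
  by have /integrableP[] := integrable_ip u u.
by apply: filterS u0 => x /= /(_ I) ->; rewrite /= mul0r.
Qed.

Lemma ip_eq0l u v : nm u = 0 -> ip u v = 0.
Proof.
move=> u0; apply/eqP; rewrite -normr_le0.
by rewrite (le_trans (ip_le u v))// u0 mul0r.
Qed.

Lemma ex_L2 (f : X -> R) : measurable_fun setT f ->
  (\int[mu]_x (f x ^+ 2)%:E < +oo)%E -> exists u : L2 mu, (u : X -> R) = f.
Proof.
move=> mf foo.
have Pf : f \in Lfun mu 2%:E.
  rewrite inE; apply/andP; split; rewrite inE//= /finite_norm unlock.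
  rewrite poweR_lty//; apply: le_lt_trans foo.
  rewrite le_eqVlt; apply/orP; left; apply/eqP.
  by apply: eq_integral => x _; rewrite /= powR_mulrn// real_normK ?num_real.
by exists (Lfun_Sub (lee1n 2) Pf); rewrite Lfun_valP.
Qed.

(** Quantitative Cauchy criterion: the tail of a geometric series bounds the
distance to the limit. *)
Lemma geometric_increments_cvg (a : R^nat) (C : R) :
  (forall k, `|a k.+1 - a k| <= C * 2^-1 ^+ k) ->
  cvgn a /\ forall n, `|limn a - a n| <= 2 * C * 2^-1 ^+ n.
Proof.
move=> aC.
have step n m : `|a (n + m)%N - a n| <= 2 * C * (2^-1 ^+ n - 2^-1 ^+ (n + m)).
  elim: m => [|m IHm]; first by rewrite addn0 !subrr normr0 mulr0.
  rewrite addnS -(subrKA (a (n + m)%N)) (le_trans (ler_normD _ _))//.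
  rewrite (le_trans (lerD (aC _) IHm))// exprS.
  by rewrite le_eqVlt; apply/orP; left; apply/eqP; field.
have C0 : 0 <= C.
  by rewrite -[C]mulr1 -(expr0 2^-1) (le_trans _ (aC 0%N)).
have step' n m : `|a (n + m)%N - a n| <= 2 * C * 2^-1 ^+ n.
  rewrite (le_trans (step n m))// ler_wpM2l ?mulr_ge0//.
  by rewrite gerBl exprn_ge0.
have ca : cvgn a.
  apply/cauchy_cvgP/cauchy_exP => e e0.
  have /cvgrPdist_lt/(_ e e0)[N _ HN] : 2 * C * 2^-1 ^+ n @[n --> \oo] --> (0 : R).
    rewrite -[X in _ --> X](mulr0 (2 * C)); apply: cvgMr.
    by apply: cvg_expr; rewrite ger0_norm// invf_lt1// ltr1n.
  exists (a N); exists N => //= k /= Nk.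
  rewrite /ball/= distrC -(subnKC Nk) (le_lt_trans (step' _ _))//.
  by have := HN N (leqnn N); rewrite /= sub0r normrN ger0_norm// !mulr_ge0// exprn_ge0.
split=> // n.
have : `|a m - a n| @[m --> \oo] --> `|limn a - a n|.
  by apply: cvg_norm; apply: cvgB => //; exact: cvg_cst.
move=> /cvg_lim <-//; apply: limr_le.
  by apply: is_cvg_norm; apply: is_cvgB => //; exact: is_cvg_cst.
exists n => // k /= nk; rewrite -(subnKC nk); exact: step'.
Qed.

End L2_inner_product.

(** * Completeness of L^2 *)

Section L2_completeness.
Context {d : measure_display} {X : measurableType d} {R : realType}.
Variable mu : {measure set X -> \bar R}.

(** Riesz-Fischer for sequences with geometric increments.  The function
M = sum_k 4^k (a_(k+1) - a_k)^2 has a finite integral, so it is finite almost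
everywhere, and where it is finite the increments of a_k are at most
sqrt(M) 2^(-k).  This gives pointwise convergence, and also the bound
|v - a_n|^2 <= 4 * 4^(-n) M, whose integral gives convergence in L^2. *)
Lemma fast_cauchy_L2_cvg (a : nat -> L2 mu) :
  (forall k, nm mu (a k.+1 - a k) <= 4^-1 ^+ k) ->
  exists v : L2 mu, nm mu (a n - v) @[n --> \oo] --> 0.
Proof.
move=> ha.
pose g k x := 4 ^+ k * (a k.+1 x - a k x) ^+ 2.
have g0 k x : 0 <= g k x by rewrite /g mulr_ge0 ?sqr_ge0 ?exprn_ge0//.
have mg k : measurable_fun setT (g k).
  apply: measurable_funM => //; apply: measurable_funX.
  by apply: measurable_funB.
pose M x := (\sum_(0 <= k <oo) (g k x)%:E)%E.
have mM : measurable_fun setT M.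
  apply: (@ge0_emeasurable_sum _ X R setT (fun k x => (g k x)%:E) xpredT) => [k x _ _|k _].
    by rewrite lee_fin.
  exact/measurable_EFinP.
(* The bound is 2^(-k), written so that its sum over k is at most 2 by
   epsilon_trick0. *)
have intg k : (\int[mu]_x (g k x)%:E <= (2 / (2 ^ k.+1)%:R)%:E)%E.
  rewrite /g; under eq_integral do rewrite EFinM.
  rewrite ge0_integralZl//; last 2 first.
  - apply/measurable_EFinP; apply: measurable_funX.
    by apply: measurable_funB.
  - by move=> x _; rewrite lee_fin sqr_ge0.
  have -> : (\int[mu]_x ((a k.+1 x - a k x) ^+ 2)%:E)%E =
      (nm mu (a k.+1 - a k) ^+ 2)%:E.
    rewrite nm_sqr /ip /Rintegral fineK; last first.
      by apply: integrable_fin_num => //; exact: integrable_ip.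
    by apply: eq_integral => x _; rewrite expr2.
  rewrite -EFinM lee_fin.
  have -> : 2 / (2 ^ k.+1)%:R = 2^-1 ^+ k :> R.
    by rewrite natrX exprS exprVn; field; rewrite expf_neq0.
  rewrite (@le_trans _ _ (4 ^+ k * (4^-1 ^+ k) ^+ 2))//.
    by rewrite ler_wpM2l ?exprn_ge0// ler_sqr ?nnegrE ?nm_ge0// exprn_ge0.
  rewrite expr2 mulrA -exprMn mulfV// expr1n mul1r.
  by apply: lerXn2r; rewrite ?nnegrE//; lra.
have intM : (\int[mu]_x M x <= 2%:E)%E.
  rewrite integral_nneseries//; last by move=> k x _; rewrite lee_fin.
    have e2 := @epsilon_trick0 R 2 xpredT (ler0n _ _).
    apply: le_trans e2; apply: lee_nneseries => //.
    by move=> k _ _; apply: integral_ge0 => x _; rewrite lee_fin.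
  by move=> k; apply/measurable_EFinP.
have M0 x : (0 <= M x)%E by apply: nneseries_ge0 => k _ _; rewrite lee_fin.
have integrableM : mu.-integrable setT M.
  apply/integrableP; split => //.
  apply: (@le_lt_trans _ _ 2%:E); last by rewrite ltry.
  by under eq_integral do rewrite gee0_abs//.
pose G := [set x | M x \is a fin_num].
have mG : measurable G.
  by rewrite /G -[X in measurable X]setTI; exact: emeasurable_fin_num.
(* Cutting off outside G makes b converge everywhere, which gives a measurable limit. *)
pose b n x : R := a n x * \1_G x.
have gM x k : G x -> g k x <= fine (M x).
  move=> Gx; rewrite -lee_fin fineK// /M.
  rewrite (nneseriesD1 (n := k))//; last by move=> i _; rewrite lee_fin.
  by rewrite leeDl//; apply: nneseries_ge0 => i _ _; rewrite lee_fin.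
have bb x k : `|b k.+1 x - b k x| <= Num.sqrt (fine (M x)) * 2^-1 ^+ k.
  rewrite /b indicE; have [/set_mem Gx|nGx] := boolP (x \in G); last first.
    by rewrite !mulr0 subrr normr0 mulr_ge0// ?sqrtr_ge0// exprn_ge0.
  rewrite !mulr1 -(@ler_pXn2r _ 2) ?nnegrE ?normr_ge0 ?mulr_ge0 ?sqrtr_ge0 ?exprn_ge0//.
  rewrite exprMn sqr_sqrtr ?fine_ge0// real_normK ?num_real//.
  rewrite -exprM mulnC exprM (_ : 2^-1 ^+ 2 = 4^-1); last by field.
  by rewrite exprVn ler_pdivlMr ?exprn_gt0// mulrC; exact: gM.
have cb x := geometric_increments_cvg _ _ (bb x).
pose v x := limn (b ^~ x).
have mb n : measurable_fun setT (b n) by apply: measurable_funM.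
have mv : measurable_fun setT v.
  apply: (@measurable_fun_cvg _ X R setT b v) => // x _.
  exact: (cb x).1.
have vb n x : (v x - b n x) ^+ 2 <= 4 * 4^-1 ^+ n * fine (M x).
  have := (cb x).2 n; rewrite -(@ler_pXn2r _ 2) ?nnegrE ?normr_ge0 ?mulr_ge0 ?sqrtr_ge0 ?exprn_ge0//.
  rewrite !exprMn sqr_sqrtr ?fine_ge0// real_normK ?num_real// => /le_trans; apply.
  rewrite -exprM mulnC exprM (_ : 2^-1 ^+ 2 = 4^-1); last by field.
  by rewrite le_eqVlt; apply/orP; left; apply/eqP; ring.
have aeG : {ae mu, forall x, G x}.
  by have := integrable_ae _ integrableM; move=> /(_ measurableT); apply: filterS => x /(_ I).
have intvb n : (\int[mu]_x ((v x - b n x) ^+ 2)%:E <= (8 * 4^-1 ^+ n)%:E)%E.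
  apply: (@le_trans _ _ (\int[mu]_x ((4 * 4^-1 ^+ n)%:E * M x))%E); last first.
    rewrite ge0_integralZl// ?lee_fin ?mulr_ge0// ?exprn_ge0//.
    apply: (@le_trans _ _ ((4 * 4^-1 ^+ n)%:E * 2%:E)%E).
      by apply: lee_wpmul2l => //; rewrite lee_fin mulr_ge0// exprn_ge0.
    by rewrite -EFinM lee_fin le_eqVlt; apply/orP; left; apply/eqP; ring.
  apply: ae_ge0_le_integral => //.
  - by move=> x _; rewrite lee_fin sqr_ge0.
  - apply/measurable_EFinP; apply: measurable_funX.
    by apply: measurable_funB.
  - by move=> x _; rewrite mule_ge0// lee_fin mulr_ge0// exprn_ge0.
  - by apply: emeasurable_funM => //.
  apply: filterS aeG => x Gx _.
  by rewrite -[M x]fineK// -EFinM lee_fin.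
have [w0 w0E] : exists u : L2 mu, (u : X -> R) = (fun x => v x - b 0%N x).
  apply: ex_L2; first by apply: measurable_funB.
  by rewrite (le_lt_trans (intvb 0%N))// ltry.
exists (w0 + a 0%N).
have key n : nm mu (a n - (w0 + a 0%N)) ^+ 2 <= 8 * 4^-1 ^+ n.
  rewrite nm_sqr -lee_fin; apply: le_trans (intvb n).
  rewrite /ip /Rintegral fineK; last first.
    by apply: integrable_fin_num => //; exact: integrable_ip.
  apply: ae_ge0_le_integral => //.
  - by move=> x _; rewrite lee_fin -expr2 sqr_ge0.
  - by have /integrableP[] := integrable_ip mu (a n - (w0 + a 0%N)) (a n - (w0 + a 0%N)).
  - by move=> x _; rewrite lee_fin sqr_ge0.
  - apply/measurable_EFinP; apply: measurable_funX.
    by apply: measurable_funB.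
  apply: filterS aeG => x Gx _.
  rewrite -expr2 lee_fin /=.
  rewrite [X in X ^+ 2 <= _](_ : _ = a n x - (w0 x + a 0%N x))//.
  rewrite w0E /b indicE mem_set// !mulr1 le_eqVlt; apply/orP; left; apply/eqP.
  ring.
have key' n : nm mu (a n - (w0 + a 0%N)) <= 3 * 2^-1 ^+ n.
  rewrite -(@ler_pXn2r _ 2) ?nnegrE ?nm_ge0 ?mulr_ge0 ?exprn_ge0//.
  rewrite (le_trans (key n))// exprMn -[in leRHS]exprM mulnC [in leRHS]exprM.
  rewrite (_ : 2^-1 ^+ 2 = 4^-1); last by field.
  by rewrite ler_wpM2r ?exprn_ge0//; lra.
apply: (@squeeze_cvgr _ _ _ _ (cst 0) (fun n => 3 * 2^-1 ^+ n)).
- by apply: nearW => n; rewrite key' nm_ge0.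
- exact: cvg_cst.
- rewrite -[X in _ --> X](mulr0 3); apply: cvgMr.
  by apply: cvg_expr; rewrite ger0_norm// invf_lt1// ltr1n.
Qed.

(** A Cauchy sequence converges as soon as a subsequence does. *)
Lemma cauchy_L2_cvg (u : nat -> L2 mu) :
  (forall e, 0 < e -> exists N, forall i j, (N <= i)%N -> (N <= j)%N ->
    nm mu (u i - u j) <= e) ->
  exists v : L2 mu, nm mu (u n - v) @[n --> \oo] --> 0.
Proof.
move=> cu.
have /choice[N HN] k : exists N, forall i j, (N <= i)%N -> (N <= j)%N ->
    nm mu (u i - u j) <= 4^-1 ^+ k by apply: cu; rewrite exprn_gt0.
(* An increasing choice of ranks with f k >= N k, so that u along f has geometric
   increments. *)
pose f k := (k + \sum_(i < k.+1) N i)%N.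
have fN k : (N k <= f k)%N by rewrite /f big_ord_recr /= addnA leq_addl.
have fk k : (k <= f k)%N by rewrite leq_addr.
have fS k : (f k <= f k.+1)%N by rewrite /f [in leqRHS]big_ord_recr/= leq_add// leq_addr.
have [v hv] : exists v : L2 mu, nm mu (u (f n) - v) @[n --> \oo] --> 0.
  apply: fast_cauchy_L2_cvg => k; apply: HN => //.
  by rewrite (leq_trans (fN k)).
exists v; apply/cvgrPdist_le => e e0.
have e20 : 0 < e / 2 by rewrite divr_gt0.
have [M HM] := cu _ e20.
move/cvgrPdist_le : hv => /(_ _ e20)[K _ HK].
exists M => //= n Mn.
rewrite sub0r normrN ger0_norm ?nm_ge0//.
have /HK : (K <= maxn K M)%N by rewrite leq_maxl.
rewrite /= sub0r normrN ger0_norm ?nm_ge0// => hv.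
rewrite (le_trans (nm_trans _ (u (f (maxn K M))) _ _))// [leRHS](splitr e) lerD// HM//.
by rewrite (leq_trans _ (fk _))// leq_maxr.
Qed.

End L2_completeness.

(** * Strongly measurable functions with values in L^2 *)

Section ae_integral.
Import HBNNSimple HBSimple.

(** The integrands may fail to be measurable, as t |-> L2_norm (f t) may for an f
that is only almost everywhere a limit of simple functions: the integral is
then a supremum over simple functions below the integrand, and multiplying
these by the indicator of a conull set does not change their integral. *)
Lemma ge0_ae_eq_integral_nonmeasurable {d} {T : measurableType d} {R : realType}
    (mu : {measure set T -> \bar R}) (D : set T) (f g : T -> \bar R) :
  (forall t, D t -> (0 <= f t)%E) -> (forall t, D t -> (0 <= g t)%E) ->
  {ae mu, forall t, D t -> f t = g t} ->
  (\int[mu]_(t in D) f t = \int[mu]_(t in D) g t)%E.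
Proof.
suff le (f' g' : T -> \bar R) :
    (forall t, D t -> (0 <= f' t)%E) -> (forall t, D t -> (0 <= g' t)%E) ->
    {ae mu, forall t, D t -> f' t = g' t} ->
    (\int[mu]_(t in D) f' t <= \int[mu]_(t in D) g' t)%E.
  move=> f0 g0 fg; apply/eqP; rewrite eq_le !le//.
  by apply: filterS fg => t + Dt => ->.
move=> f0 g0 [N [mN N0 fgN]]; rewrite !ge0_integralE//.
apply: ge_ereal_sup => _ [h /= hf <-].
pose h' := mul_nnsfun h (indic_nnsfun R (measurableC mN)).
have mE t : mindic R (measurableC mN) t = (t \in ~` N)%:R :> R by rewrite /mindic indicE.
have -> : sintegral mu h = sintegral mu h'.
  rewrite -!integralT_nnsfun; apply: ae_eq_integral => //.
  - exact/measurable_EFinP.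
  - exact/measurable_EFinP.
  exists N; split => // t /= /not_implyP[_] hh'.
  apply: contrapT => nNt; apply: hh'.
  by rewrite mE mem_set ?mulr1.
apply: ereal_sup_ubound; exists h' => //= t.
rewrite mE; have [|nNt] := boolP (t \in ~` N); last first.
  by rewrite mulr0 patchE; case: ifPn => // /set_mem; exact: g0.
move=> /set_mem nNt; rewrite mulr1 (le_trans (hf t))// !patchE.
case: ifPn => // /set_mem Dt.
rewrite (_ : f' t = g' t)//; apply: contrapT => fg.
by apply: nNt; apply: fgN => /= /(_ Dt).
Qed.

End ae_integral.

Section strong_measurability.
Import finmap HBNNSimple HBSimple.
Context {d : measure_display} {X : measurableType d} {R : realType}.
Variable mu : {measure set X -> \bar R}.
Local Notation lambda := (@lebesgue_measure R).
Local Notation nm := (nm mu).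
Local Notation ip := (ip mu).
Local Notation simple := (simple_fun mu).
Implicit Types (D : set R) (f g : R -> L2 mu).

Lemma L2_norm_cvg0 (a : nat -> L2 mu) :
  (fun k => L2_norm (a k)) @ \oo --> 0%E <-> nm (a k) @[k --> \oo] --> 0.
Proof.
rewrite (_ : (fun k => L2_norm (a k)) = (fun k => (nm (a k))%:E)).
  by split => [/fine_cvgP[]//|h]; apply/fine_cvgP; split => //; exact: nearW.
by apply/funext => k; rewrite L2_normE.
Qed.

Lemma integral_L2_norm D f :
  (\int[lambda]_(t in D) L2_norm (f t) = \int[lambda]_(t in D) (nm (f t))%:E)%E.
Proof. by apply: eq_integral => t _; rewrite L2_normE. Qed.

(** Strong measurability with convergence everywhere on [D].  Everywhere convergence
makes the scalar functions derived from [f] measurable even though null sets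
need not be Borel; [strongly_measurable_smeas] reduces to this case. *)
Definition smeas D f := exists s : nat -> simple, forall t, D t ->
  nm (sf_eval (s k) t - f t) @[k --> \oo] --> 0.

Lemma smeas_strongly_measurable D f : smeas D f -> strongly_measurable D f.
Proof.
by move=> [s sf]; exists s; apply: aeW => t Dt; apply/L2_norm_cvg0; exact: sf.
Qed.

Lemma smeas_sub D E f : D `<=` E -> smeas E f -> smeas D f.
Proof. by move=> DE [s sf]; exists s => t /DE; exact: sf. Qed.

Lemma ex_simple (I : Type) (r : seq I) (A : I -> set R) (v : I -> L2 mu) :
  (forall i, measurable (A i)) -> (forall i, (lambda (A i) < +oo)%E) ->
  exists s : simple,
    forall t, sf_eval s t = \sum_(i <- r) \1_(A i) t *: v i.
Proof.
move=> mA fA.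
case: r => [|i0 r].
  exists (@Build_simple_fun _ X R mu 0 (fun=> set0) (fun=> 0)
     (fun=> measurable0) (fun=> ltac:(by rewrite measure0))) => t.
  by rewrite /sf_eval/= big_ord0 big_nil.
pose r' := i0 :: r.
exists (@Build_simple_fun _ X R mu (size r') (fun j => A (nth i0 r' j))
  (fun j => v (nth i0 r' j)) (fun j => mA _) (fun j => fA _)) => t.
by rewrite /sf_eval/= -/r' (big_nth i0) big_mkord.
Qed.

Lemma ip_sf_eval (s : simple) t v :
  ip (sf_eval s t) v = \sum_(i < sf_size s) \1_(sf_set i) t * ip (sf_val i) v.
Proof. by rewrite /sf_eval ip_suml; apply: eq_bigr => i _; rewrite ipZl. Qed.

Lemma measurable_sf_ip D (s s' : simple) :
  measurable_fun D (fun t => ip (sf_eval s t) (sf_eval s' t)).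
Proof.
rewrite (_ : (fun t => _) = (fun t => \sum_(i < sf_size s) \1_(sf_set i) t *
    \sum_(j < sf_size s') \1_(sf_set j) t * ip (sf_val j) (sf_val i))).
  apply: measurable_sum => i; apply: measurable_funM.
    by apply: measurable_indic; exact: sf_measurable.
  apply: measurable_sum => j; apply: measurable_funM => //.
  by apply: measurable_indic; exact: sf_measurable.
apply/funext => t; rewrite ip_sf_eval; apply: eq_bigr => i _; congr (_ * _).
by rewrite ipC ip_sf_eval.
Qed.

Lemma nm_cvg (a : nat -> L2 mu) u :
  nm (a k - u) @[k --> \oo] --> 0 -> nm (a k) @[k --> \oo] --> nm u.
Proof.
move=> au; apply/cvgrPdist_le => e e0.
move/cvgrPdist_le : au => /(_ _ e0); apply: filterS => k.
rewrite sub0r normrN ger0_norm ?nm_ge0//; apply: le_trans.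
by rewrite distrC; exact: ler_nmB.
Qed.

Lemma ip_cvg (a b : nat -> L2 mu) u v :
  nm (a k - u) @[k --> \oo] --> 0 -> nm (b k - v) @[k --> \oo] --> 0 ->
  ip (a k) (b k) @[k --> \oo] --> ip u v.
Proof.
move=> au bv.
have h : nm (a k - u) * nm (b k) + nm (b k - v) * nm u @[k --> \oo] --> 0.
  rewrite -[X in _ --> X](addr0 0) -{1}[0](mul0r (nm v)) -[X in _ --> _ + X](mul0r (nm u)).
  apply: cvgD; first by apply: cvgM => //; exact: nm_cvg.
  by apply: cvgM => //; exact: cvg_cst.
apply/cvgrPdist_le => e e0.
move/cvgrPdist_le : h => /(_ _ e0); apply: filterS => k.
rewrite sub0r normrN ger0_norm; last by rewrite addr_ge0// mulr_ge0// nm_ge0.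
apply: le_trans; rewrite distrC.
rewrite -(subrKA (ip u (b k))) -ipBl (ipC _ u (b k)) (ipC _ u v) -ipBl.
by rewrite (le_trans (ler_normD _ _))// lerD// ip_le.
Qed.

Lemma measurable_smeas_ip D f g : smeas D f -> smeas D g ->
  measurable_fun D (fun t => ip (f t) (g t)).
Proof.
move=> [s sf] [s' sg].
apply: (@measurable_fun_cvg _ _ R D (fun k t => ip (sf_eval (s k) t) (sf_eval (s' k) t))).
  by move=> k; exact: measurable_sf_ip.
by move=> t Dt; apply: ip_cvg; [exact: sf|exact: sg].
Qed.

Lemma measurable_smeas_ip_cst D f v : smeas D f ->
  measurable_fun D (fun t => ip (f t) v).
Proof.
move=> [s sf].
apply: (@measurable_fun_cvg _ _ R D (fun k t => ip (sf_eval (s k) t) v)).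
  move=> k; under eq_fun do rewrite ip_sf_eval.
  apply: measurable_sum => i; apply: measurable_funM => //.
  by apply: measurable_indic; exact: sf_measurable.
move=> t Dt; apply: ip_cvg; first exact: sf.
by rewrite subrr nm0; exact: cvg_cst.
Qed.

(** The norm is the square root of [ip (f t) (f t)], a limit of the measurable
scalar functions given by simple functions. *)
Lemma measurable_smeas_nm D f : smeas D f ->
  measurable_fun D (fun t => nm (f t)).
Proof.
move=> sf; rewrite (_ : (fun t => _) = (fun t => (ip (f t) (f t)) `^ 2^-1)).
  apply: (@measurableT_comp _ _ _ _ _ _ (@powR R ^~ 2^-1)) => //.
  exact: measurable_smeas_ip.
apply/funext => t; rewrite -nm_sqr powR12_sqrt ?sqr_ge0//.
by rewrite sqrtr_sqr ger0_norm// nm_ge0.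
Qed.

Lemma smeas_sf_eval D (s : simple) : smeas D (sf_eval s).
Proof. by exists (fun=> s) => t _; rewrite subrr nm0; exact: cvg_cst. Qed.

Lemma smeasD D f g : smeas D f -> smeas D g -> smeas D (fun t => f t + g t).
Proof.
move=> [s sf] [s' sg].
have /choice[q qE] k : exists q : simple,
    forall t, sf_eval q t = sf_eval (s k) t + sf_eval (s' k) t.
  have [||q qE] := @ex_simple ('I_(sf_size (s k)) + 'I_(sf_size (s' k)))%type
    (index_enum _) (fun i => match i with inl i => sf_set i | inr i => sf_set i end)
    (fun i => match i with inl i => sf_val i | inr i => sf_val i end).
  - by move=> [i|i]; exact: sf_measurable.
  - by move=> [i|i]; exact: sf_finite.
  by exists q => t; rewrite qE big_sumType.
exists q => t Dt.
apply: (@squeeze_cvgr _ _ _ _ (cst 0)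
  (fun k => nm (sf_eval (s k) t - f t) + nm (sf_eval (s' k) t - g t))).
- by apply: nearW => k; rewrite nm_ge0/= qE opprD addrACA nmD.
- exact: cvg_cst.
- by rewrite -[X in _ --> X](addr0 0); apply: cvgD; [exact: sf|exact: sg].
Qed.

(** The scalar function is a limit of real simple functions, and the product of two
simple functions is one, supported on the intersections of their level sets. *)
Lemma smeasZ D (k : R -> R) f : measurable D -> measurable_fun D k ->
  smeas D f -> smeas D (fun t => k t *: f t).
Proof.
move=> mD mk [s sf].
have [|a ak] := @approximation_sfun _ R R (EFin \o k) D mD.
  exact/measurable_EFinP.
have /choice[q qE] n : exists q : simple,
    forall t, sf_eval q t = a n t *: sf_eval (s n) t.
  have [||q qE] := @ex_simple ('I_(sf_size (s n)) * R)%type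
    [seq (i, y) | i <- index_enum 'I_(sf_size (s n)), y <- fset_set (range (a n))]
    (fun p => sf_set p.1 `&` (a n @^-1` [set p.2]))
    (fun p => p.2 *: sf_val p.1).
  - by move=> [i y]/=; apply: measurableI => //; exact: sf_measurable.
  - move=> [i y]/=; apply: le_lt_trans (sf_finite i).
    have mi := sf_measurable i.
    have ma : measurable (a n @^-1` [set y]) by [].
    exact: measureIl.
  exists q => t; rewrite qE big_allpairs_dep /sf_eval/= scaler_sumr.
  apply: eq_bigr => i _; rewrite (fimfunE (a n) t) fsbig_finite//=.
  rewrite scaler_suml; apply: eq_bigr => y _.
  by rewrite indicI /= !scalerA; congr (_ *: _); ring.
exists q => t Dt.
apply: (@squeeze_cvgr _ _ _ _ (cst 0) (fun n =>
  `|a n t| * nm (sf_eval (s n) t - f t) + `|a n t - k t| * nm (f t))).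
- apply: nearW => n; rewrite nm_ge0/= qE -!nmZ.
  apply: le_trans (nmD _ _ _).
  by rewrite scalerBr scalerBl subrKA.
- exact: cvg_cst.
have akt : a n t @[n --> \oo] --> k t by have /fine_cvgP[] := ak t Dt.
rewrite -[X in _ --> X](addr0 0) -{1}[0](mulr0 `|k t|) -[X in _ --> _ + X](mul0r (nm (f t))).
apply: cvgD.
  by apply: cvgM; [exact: cvg_norm|exact: sf].
apply: cvgM; last exact: cvg_cst.
by apply/norm_cvg0P; apply/subr_cvg0.
Qed.

Lemma smeas_cst D v : measurable D -> (lambda D < +oo)%E -> smeas D (cst v).
Proof.
move=> mD fD; have [q qE] := @ex_simple unit [:: tt] (fun=> D) (fun=> v)
  (fun=> mD) (fun=> fD).
exists (fun=> q) => t Dt; rewrite qE big_seq1 indicE mem_set// scale1r subrr nm0.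
exact: cvg_cst.
Qed.

End strong_measurability.

(** * Existence of the Bochner integral and its pairing with vectors *)

Section bochner_integral.
Context {d : measure_display} {X : measurableType d} {R : realType}.
Variable mu : {measure set X -> \bar R}.
Local Notation lambda := (@lebesgue_measure R).
Local Notation nm := (nm mu).
Local Notation ip := (ip mu).
Local Notation simple := (simple_fun mu).
Local Notation smeas := (smeas mu).
Implicit Types (D : set R) (f g : R -> L2 mu).

(** Norms by duality; the inner product with [u] itself suffices. *)
Lemma nm_le_pairing (u : L2 mu) (C : R) : 0 <= C ->
  (forall psi, `|ip u psi| <= C * nm psi) -> nm u <= C.
Proof.
move=> C0 /(_ u); rewrite -nm_sqr ger0_norm ?sqr_ge0// expr2.
have := nm_ge0 mu u; rewrite le_eqVlt => /predU1P[<- //|u0].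
by rewrite ler_pM2r.
Qed.

Lemma ae_imp (P Q : R -> Prop) : (forall t, P t -> Q t) ->
  {ae lambda, forall t, P t} -> {ae lambda, forall t, Q t}.
Proof. exact: (@filterS _ _ (ae_filter_ringOfSetsType lambda)). Qed.

Lemma ae_imp2 (P Q S : R -> Prop) : (forall t, P t -> Q t -> S t) ->
  {ae lambda, forall t, P t} -> {ae lambda, forall t, Q t} ->
  {ae lambda, forall t, S t}.
Proof. exact: (@filterS2 _ _ (ae_filter_ringOfSetsType lambda)). Qed.

Lemma Rintegral_sum_fin (D : set R) (mD : measurable D) (I : Type) (r : seq I) (F : I -> R -> R) :
  (forall i, lambda.-integrable D (EFin \o F i)) ->
  lambda.-integrable D (fun t : R => (\sum_(i <- r) F i t)%:E) /\
  \int[lambda]_(t in D) (\sum_(i <- r) F i t) =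
    \sum_(i <- r) \int[lambda]_(t in D) F i t.
Proof.
move=> iF; elim: r => [|i r [IH1 IH2]].
  split; first by under eq_fun do rewrite big_nil; exact: integrable0.
  by rewrite big_nil; under eq_Rintegral do rewrite big_nil; rewrite Rintegral_cst// mul0r.
split.
  rewrite (_ : (fun t : R => _) = (fun t : R => ((F i t)%:E + (\sum_(i <- r) F i t)%:E)%E)).
    by apply: integrableD => //; exact: iF.
  by apply/funext => t; rewrite big_cons EFinD.
by rewrite big_cons -IH2 -RintegralD//; apply: eq_Rintegral => t _; rewrite big_cons.
Qed.

Lemma integrable_indicM (D : set R) (mD : measurable D) (A : set R) (c : R) :
  measurable A -> (lambda A < +oo)%E ->
  lambda.-integrable D (fun t : R => (\1_A t * c)%:E) /\
  \int[lambda]_(t in D) (\1_A t * c) = fine (lambda (D `&` A)) * c.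
Proof.
move=> mA fA.
have iA : lambda.-integrable D (EFin \o \1_A).
  apply/integrableP; split; first exact/measurable_EFinP/measurable_indic.
  under eq_integral do rewrite /= ger0_norm//.
  rewrite integral_indic//; apply: le_lt_trans fA.
  exact: measureIl.
split.
  by under eq_fun do rewrite EFinM; exact: integrableZr.
by rewrite RintegralZr// /Rintegral integral_indic// setIC.
Qed.

Lemma sf_pairing (D : set R) (mD : measurable D) (s : simple) psi :
  lambda.-integrable D (fun t : R => (ip (sf_eval s t) psi)%:E) /\
  ip (sf_integral D s) psi = \int[lambda]_(t in D) ip (sf_eval s t) psi.
Proof.
have [|i1 i2] := @Rintegral_sum_fin D mD 'I_(sf_size s) (index_enum _)
  (fun i t => \1_(sf_set i) t * ip (sf_val i) psi).
  by move=> i; apply: (integrable_indicM _ mD _ _ (sf_measurable i) (sf_finite i)).1.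
split; first by under eq_fun do rewrite ip_sf_eval.
under eq_Rintegral do rewrite ip_sf_eval.
rewrite i2 /sf_integral ip_suml; apply: eq_bigr => i _.
by rewrite ipZl (integrable_indicM _ mD _ _ (sf_measurable i) (sf_finite i)).2.
Qed.

Lemma smeasN D f : measurable D -> smeas D f -> smeas D (fun t : R => - f t).
Proof.
move=> mD sf; have := smeasZ mu D (cst (-1)) f mD (measurable_cst _) sf.
by under eq_fun do rewrite scaleN1r.
Qed.

Lemma smeasB D f g : measurable D -> smeas D f -> smeas D g ->
  smeas D (fun t : R => f t - g t).
Proof. by move=> mD sf sg; apply: smeasD => //; exact: smeasN. Qed.

Lemma integrable_nm D f : smeas D f ->
  (\int[lambda]_(t in D) (nm (f t))%:E < +oo)%E ->
  lambda.-integrable D (fun t : R => (nm (f t))%:E).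
Proof.
move=> sf foo; apply/integrableP; split.
  have h : measurable_fun D (fun t => nm (f t)) := measurable_smeas_nm mu D f sf.
  exact/measurable_EFinP.
by under eq_integral do rewrite gee0_abs ?lee_fin ?nm_ge0//.
Qed.

Lemma integrable_ip_smeas D f psi : measurable D -> smeas D f ->
  lambda.-integrable D (fun t : R => (nm (f t))%:E) ->
  lambda.-integrable D (fun t : R => (ip (f t) psi)%:E).
Proof.
move=> mD sf fi.
have fi2 : lambda.-integrable D (fun t : R => ((nm (f t))%:E * (nm psi)%:E)%E).
  exact: integrableZr.
apply: le_integrable fi2 => //.
  have h : measurable_fun D (fun t => ip (f t) psi) by exact: measurable_smeas_ip_cst.
  exact/measurable_EFinP.
move=> t Dt /=; rewrite lee_fin (le_trans (ip_le _ _ _))//.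
by rewrite ler_norm.
Qed.

(** The values of [g] on the exceptional set may make its norm non-measurable, hence
the use of [ge0_ae_eq_integral_nonmeasurable]. *)
Lemma is_bochner_integral_ae D f g v :
  {ae lambda, forall t, D t -> nm (f t - g t) = 0} ->
  is_bochner_integral D f v -> is_bochner_integral D g v.
Proof.
move=> fg [[s sf] [s' [s'f s'v]]].
have E (u : L2 mu) t : nm (f t - g t) = 0 -> nm (u - f t) = nm (u - g t).
  move=> fg0; apply/eqP; rewrite eq_le; apply/andP; split.
    by rewrite (le_trans (nm_trans _ (g t) _ _))// (nmBC _ (g t)) fg0 addr0.
  by rewrite (le_trans (nm_trans _ (f t) _ _))// fg0 addr0.
split.
  exists s; apply: (ae_imp2 _ _ _ _ fg sf) => t fg0 {}sf Dt.
  apply/L2_norm_cvg0; under eq_fun do rewrite -E ?fg0//.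
  by apply/L2_norm_cvg0; exact: sf.
exists s'; split => //.
rewrite [X in X @ _ --> _](_ : _ =
  (fun k => \int[lambda]_(t in D) L2_norm (sf_eval (s' k) t - f t)%R)%E)//.
apply/funext => k; apply: ge0_ae_eq_integral_nonmeasurable.
- by move=> t _; rewrite L2_normE lee_fin nm_ge0.
- by move=> t _; rewrite L2_normE lee_fin nm_ge0.
by apply: (ae_imp _ _ _ fg) => t fg0 Dt; rewrite !L2_normE E// fg0.
Qed.

Lemma sf_integral_dist D f (s : simple) psi : measurable D -> smeas D f ->
  lambda.-integrable D (fun t : R => (nm (f t))%:E) ->
  lambda.-integrable D (fun t : R => (nm (sf_eval s t - f t))%:E) ->
  `|ip (sf_integral D s) psi - \int[lambda]_(t in D) ip (f t) psi| <=
  (\int[lambda]_(t in D) nm (sf_eval s t - f t)) * nm psi.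
Proof.
move=> mD sf fi si.
rewrite (sf_pairing _ mD s psi).2 -RintegralB//; last 2 first.
- exact: (sf_pairing _ mD s psi).1.
- exact: integrable_ip_smeas.
have si' : lambda.-integrable D (fun t : R => (ip (sf_eval s t - f t) psi)%:E).
  by apply: integrable_ip_smeas => //; apply: smeasB => //; exact: smeas_sf_eval.
under eq_Rintegral do rewrite -ipBl.
rewrite (le_trans (le_normr_Rintegral _ _))// -RintegralZr//.
apply: le_Rintegral => //.
- exact: (integrable_abse si').
- have : lambda.-integrable D (fun t : R => ((nm (sf_eval s t - f t))%:E * (nm psi)%:E)%E).
    exact: integrableZr.
  by [].
- by move=> t Dt; exact: ip_le.
Qed.

(** Both sides are limits of <int s_k, psi> = int <s_k, psi>. *)
Lemma is_bochner_integral_pairing D f v : measurable D -> smeas D f ->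
  lambda.-integrable D (fun t : R => (nm (f t))%:E) ->
  is_bochner_integral D f v ->
  forall psi, ip v psi = \int[lambda]_(t in D) ip (f t) psi.
Proof.
move=> mD sf fi [_ [s [s0 sv]]] psi.
set J := (X in _ = X).
have sm k : smeas D (fun t : R => sf_eval (s k) t - f t).
  by apply: smeasB => //; exact: smeas_sf_eval.
have h1 : ip (sf_integral D (s k)) psi @[k --> \oo] --> ip v psi.
  apply: ip_cvg; first by apply/L2_norm_cvg0; exact: sv.
  by under eq_fun do rewrite subrr nm0; exact: cvg_cst.
have /fine_cvgP[s1 s2] := s0.
have h2 : (\int[lambda]_(t in D) nm (sf_eval (s k) t - f t)) * nm psi @[k --> \oo] --> 0.
  rewrite -[X in _ --> X](mul0r (nm psi)); apply: cvgM; last exact: cvg_cst.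
  rewrite [X in X @ _ --> _](_ : _ = fine \o
    (fun k => \int[lambda]_(t in D) L2_norm (sf_eval (s k) t - f t)%R)%E)//.
  by apply/funext => k /=; rewrite integral_L2_norm.
have h3 : ip (sf_integral D (s k)) psi @[k --> \oo] --> J.
  apply/cvgrPdist_le => e e0.
  move/cvgrPdist_le : h2 => /(_ _ e0); apply: filterS2 s1 => k s1k.
  rewrite sub0r normrN distrC; apply: le_trans.
  rewrite (le_trans _ (ler_norm _))//; apply: sf_integral_dist => //.
  apply: integrable_nm => //.
  by rewrite -integral_L2_norm -ge0_fin_numE//; apply: integral_ge0 => t _;
    rewrite L2_normE lee_fin nm_ge0.
exact: (cvg_unique _ h1 h3).
Qed.

Lemma bochner_integralP D f : (exists v, is_bochner_integral D f v) ->
  is_bochner_integral D f (bochner_integral D f).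
Proof. by move=> [v fv]; exact: (xgetPex 0 (ex_intro _ v fv)). Qed.

(** Removing from the supports of the approximants a Borel null set that contains the
points of divergence gives convergence to 0 there. *)
Lemma strongly_measurable_smeas D f : strongly_measurable D f ->
  exists N : set R, [/\ measurable N, lambda N = 0 &
    smeas D (fun t : R => \1_(~` N) t *: f t)].
Proof.
move=> [s [N [mN N0 sN]]]; exists N; split => //.
have mA k (i : 'I_(sf_size (s k))) : measurable (sf_set i `&` ~` N).
  by apply: measurableI; [exact: sf_measurable|exact: measurableC].
have fA k (i : 'I_(sf_size (s k))) : (lambda (sf_set i `&` ~` N) < +oo)%E.
  apply: le_lt_trans (sf_finite i).
  have mi := sf_measurable i; have mN' := measurableC mN; exact: measureIl.
exists (fun k => @Build_simple_fun _ X R mu _ _ (@sf_val _ _ _ _ (s k)) (mA k) (fA k)).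
move=> t Dt.
have E k : sf_eval (@Build_simple_fun _ X R mu _ _ (@sf_val _ _ _ _ (s k)) (mA k) (fA k)) t
    = \1_(~` N) t *: sf_eval (s k) t.
  rewrite /sf_eval/= scaler_sumr; apply: eq_bigr => i _.
  by rewrite indicI/= scalerA mulrC.
under eq_fun do rewrite E -scalerBr nmZ.
rewrite indicE; have [/set_mem nNt|_] := boolP (t \in _); last first.
  by under eq_fun do rewrite normr0 mul0r; exact: cvg_cst.
under eq_fun do rewrite normr1 mul1r.
apply/L2_norm_cvg0; apply: contrapT => h; apply: nNt; apply: sN => /=.
by move=> /(_ Dt).
Qed.

(** The simple function s_k is cut off where |s_k| > 2 |f|.  The truncated
approximants q_k still converge to f pointwise, and now |q_k - f| <= 3 |f|, so
int |q_k - f| tends to 0 by dominated convergence.  Hence the integrals of q_k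
form a Cauchy sequence in L^2. *)
Lemma ex_bochner_integral D f : measurable D -> smeas D f ->
  lambda.-integrable D (fun t : R => (nm (f t))%:E) ->
  exists v, is_bochner_integral D f v.
Proof.
move=> mD sf fi; have [s sfs] := sf.
pose E k := D `&` [set t | nm (sf_eval (s k) t) <= 2 * nm (f t)].
have mnf : measurable_fun D (fun t => nm (f t)) := measurable_smeas_nm mu D f sf.
have mE k : measurable (E k).
  have := measurable_smeas_nm mu D _ (smeas_sf_eval mu D (s k)).
  move=> mns; apply: measurable_fun_le => //.
  exact: measurable_funM.
have mA k (i : 'I_(sf_size (s k))) : measurable (sf_set i `&` E k).
  by apply: measurableI => //; exact: sf_measurable.
have fA k (i : 'I_(sf_size (s k))) : (lambda (sf_set i `&` E k) < +oo)%E.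
  apply: le_lt_trans (sf_finite i).
  have mi := sf_measurable i; have mN' := mE k; exact: measureIl.
pose q k := @Build_simple_fun _ X R mu _ _ (@sf_val _ _ _ _ (s k)) (mA k) (fA k).
have qE k t : sf_eval (q k) t = \1_(E k) t *: sf_eval (s k) t.
  rewrite /sf_eval/= scaler_sumr; apply: eq_bigr => i _.
  by rewrite indicI/= scalerA mulrC.
have qle k t : D t -> nm (sf_eval (q k) t - f t) <= 3 * nm (f t).
  move=> Dt; rewrite qE indicE; have [/set_mem[_ /= h]|_] := boolP (t \in _).
    by rewrite scale1r (le_trans (nmB _ _ _))//; lra.
  by rewrite scale0r sub0r nmN; have := nm_ge0 mu (f t); lra.
have qcvg t : D t -> nm (sf_eval (q k) t - f t) @[k --> \oo] --> 0.
  move=> Dt; have [f0|fn0] := eqVneq (nm (f t)) 0.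
    rewrite (_ : (fun k => _) = (fun=> 0)); first exact: cvg_cst.
    apply/funext => k; apply/eqP; rewrite eq_le nm_ge0 andbT.
    by rewrite (le_trans (qle k t Dt))// f0 mulr0.
  have fp : 0 < nm (f t) by rewrite lt_def fn0 nm_ge0.
  have := sfs t Dt; apply: cvg_trans; apply: near_eq_cvg.
  have /cvgrPdist_le/(_ _ fp) := sfs t Dt; apply: filterS => k.
  rewrite sub0r normrN ger0_norm ?nm_ge0// => h.
  rewrite qE indicE mem_set ?scale1r//; split => //=.
  have := nmD mu (sf_eval (s k) t - f t) (f t); rewrite subrK; lra.
have sq k : smeas D (fun t => sf_eval (q k) t - f t).
  by apply: smeasB => //; exact: smeas_sf_eval.
have iq k : lambda.-integrable D (fun t : R => (nm (sf_eval (q k) t - f t))%:E).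
  have i3 : lambda.-integrable D (fun t : R => (3%:E * (nm (f t))%:E)%E).
    exact: integrableZl.
  apply: le_integrable i3 => //.
    have h : measurable_fun D (fun t => nm (sf_eval (q k) t - f t)).
      exact: measurable_smeas_nm.
    exact/measurable_EFinP.
  move=> t Dt /=; rewrite lee_fin ger0_norm ?nm_ge0//.
  by rewrite (le_trans (qle _ _ Dt))// ler_norm.
have q0 : (fun k => \int[lambda]_(t in D) L2_norm (sf_eval (q k) t - f t)%R)%E
      @ \oo --> 0%E.
  under eq_fun do rewrite integral_L2_norm.
  have [|||||] := @dominated_convergence _ _ _ lambda D mD
    (fun k t => (nm (sf_eval (q k) t - f t))%:E) (cst 0%E)
    (fun t => (3%:E * (nm (f t))%:E)%E).
  - by move=> k; have /integrableP[] := iq k.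
  - exact: measurable_cst.
  - apply: aeW => t Dt; apply/fine_cvgP; split; first exact: nearW.
    exact: qcvg.
  - exact: integrableZl.
  - apply: aeW => t k Dt /=; rewrite -EFinM lee_fin ger0_norm ?nm_ge0//.
    exact: qle.
  by move=> _ _; rewrite integral0.
pose G k := \int[lambda]_(t in D) nm (sf_eval (q k) t - f t).
have G0 k : 0 <= G k by apply: Rintegral_ge0 => t _; exact: nm_ge0.
have Gc : G k @[k --> \oo] --> 0.
  have /fine_cvgP[_] := q0; rewrite [X in X @ _ --> _ -> _](_ : _ = G)//.
  by apply/funext => k /=; rewrite integral_L2_norm.
have [v hv] : exists v, nm (sf_integral D (q k) - v) @[k --> \oo] --> 0.
  apply: cauchy_L2_cvg => e e0.
  have e20 : 0 < e / 2 by rewrite divr_gt0.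
  move/cvgrPdist_le : Gc => /(_ _ e20)[N _ HN]; exists N => i j Ni Nj.
  apply: nm_le_pairing; first exact: ltW.
  move=> psi; rewrite ipBl -(subrKA (\int[lambda]_(t in D) ip (f t) psi)).
  rewrite (le_trans (ler_normD _ _))// [in leRHS](splitr e) mulrDl lerD//.
    rewrite (le_trans (sf_integral_dist D f (q i) psi mD sf fi (iq i)))//.
    rewrite ler_wpM2r ?nm_ge0//.
    by have := HN i Ni; rewrite /= sub0r normrN ger0_norm.
  rewrite distrC (le_trans (sf_integral_dist D f (q j) psi mD sf fi (iq j)))//.
  rewrite ler_wpM2r ?nm_ge0//.
  by have := HN j Nj; rewrite /= sub0r normrN ger0_norm.
exists v; split; first exact: smeas_strongly_measurable.
by exists q; split => //; apply/L2_norm_cvg0.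
Qed.

(** Used for functions [f] known only up to null sets, with [g] an everywhere strongly
measurable version. *)
Lemma bochner_integral_pairing D f g : measurable D -> smeas D g ->
  lambda.-integrable D (fun t : R => (nm (g t))%:E) ->
  {ae lambda, forall t, D t -> nm (f t - g t) = 0} ->
  forall psi, ip (bochner_integral D f) psi = \int[lambda]_(t in D) ip (g t) psi.
Proof.
move=> mD sg gi fg psi.
have fg' : {ae lambda, forall t, D t -> nm (g t - f t) = 0}.
  by apply: (ae_imp _ _ _ fg) => t h Dt; rewrite nmBC h.
apply: is_bochner_integral_pairing => //.
apply: (is_bochner_integral_ae _ _ _ _ fg).
apply: bochner_integralP.
have [v gv] := ex_bochner_integral D g mD sg gi.
by exists v; apply: (is_bochner_integral_ae _ _ _ _ fg').
Qed.

End bochner_integral.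

Section lipschitz_measurable.
Context {d : measure_display} {X : measurableType d} {R : realType}.
Variable mu : {measure set X -> \bar R}.
Local Notation lambda := (@lebesgue_measure R).

(** The approximants are the step functions on the n + 1 equal parts of [p, q[ that
take the value of [f] at the left end of each part. *)
Lemma smeas_lipschitz (D : set R) (f : R -> L2 mu) (p q L : R) : p < q -> 0 <= L ->
  (forall t t', p <= t < q -> p <= t' < q -> nm mu (f t - f t') <= L * `|t - t'|) ->
  smeas mu D (fun t => \1_(`[p, q[) t *: f t).
Proof.
move=> pq L0 fL.
have qp0 : 0 < q - p by lra.
pose r n (i : nat) : R := p + (q - p) * (i%:R / n.+1%:R).
have rS n i : r n i < r n i.+1.
  by rewrite /r ltrD2l ltr_pM2l// ltr_pM2r ?invr_gt0 ?ltr0n// ltr_nat.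
pose A n (i : 'I_n.+1) : set R := `[r n i, r n i.+1[%classic.
have /choice[s sE] n : exists s : simple_fun mu, forall t,
    sf_eval s t = \sum_(i < n.+1) \1_(A n i) t *: f (r n i).
  have [||s sE] := @ex_simple _ _ _ mu 'I_n.+1 (index_enum _) (A n) (fun i => f (r n i)).
  - by move=> i; exact: measurable_itv.
  - by move=> i; rewrite /A lebesgue_measure_itv/= lte_fin rS -EFinB ltry.
  by exists s.
exists s => t Dt.
have rp n i : p <= r n i.
  by rewrite /r lerDl mulr_ge0 ?(ltW qp0)// mulr_ge0.
have rq n i : (i <= n.+1)%N -> r n i <= q.
  move=> i_n; rewrite /r -lerBrDl ler_piMr ?(ltW qp0)//.
  by rewrite ler_pdivrMr ?ltr0n// mul1r ler_nat.
have rmono n i j : (i <= j)%N -> r n i <= r n j.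
  by move=> ij; rewrite /r lerD2l ler_pM2l// ler_pM2r ?invr_gt0 ?ltr0n// ler_nat.
rewrite indicE; have [/set_mem|nt] := boolP (t \in _); last first.
  rewrite (_ : (fun n => _) = (fun=> 0)); first exact: cvg_cst.
  apply/funext => n; rewrite sE scale0r subr0 big1 ?nm0// => i _.
  rewrite indicE memNset ?scale0r//.
  rewrite /A /= in_itv/= => /andP[h1 h2]; move/negP : nt; apply; apply/mem_set.
  rewrite /= in_itv/= (le_trans (rp n i) h1)/= (lt_le_trans h2)//.
  by apply: rq; rewrite ltn_ord.
rewrite /= in_itv/= => /andP[pt tq].
apply: (@squeeze_cvgr _ _ _ _ (cst 0) (fun n => (L * (q - p)) * n.+1%:R^-1)); last 2 first.
- exact: cvg_cst.
- rewrite -[X in _ --> X](mulr0 (L * (q - p))); apply: cvgMr; exact: cvg_harmonic.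
apply: nearW => n; rewrite nm_ge0/= sE scale1r.
pose y := (t - p) / (q - p) * n.+1%:R.
have y0 : 0 <= y by rewrite mulr_ge0// divr_ge0// subr_ge0// ltW.
have yn : y < n.+1%:R by rewrite /y gtr_pMl ?ltr0n// ltr_pdivrMr// mul1r; lra.
have /andP[k1 k2] := truncn_itv y0.
set k := Num.truncn y in k1 k2.
have kn : (k < n.+1)%N by rewrite -(@ltr_nat R); exact: le_lt_trans yn.
have n0 : 0 < n.+1%:R :> R by rewrite ltr0n.
have tE : t = p + (q - p) * (y / n.+1%:R).
  by rewrite /y mulfK ?gt_eqF// [_ * (_ / _)]mulrC divfK ?gt_eqF// addrC subrK.
have At : A n (Ordinal kn) t.
  rewrite /A /= in_itv/= [t in _ <= t]tE [t in t < _]tE /r.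
  rewrite lerD2l ler_pM2l// ler_pM2r ?invr_gt0// k1/=.
  by rewrite ltrD2l ltr_pM2l// ltr_pM2r ?invr_gt0.
rewrite (bigD1 (Ordinal kn))//= [X in _ + X - _]big1 ?addr0; last first.
  move=> i ik; rewrite indicE memNset ?scale0r// /A /= in_itv/= => /andP[h1 h2].
  move: At; rewrite /A /= in_itv/= => /andP[h3 h4].
  have ik' : (i < k.+1)%N.
    by rewrite ltnNge; apply/negP => /rmono - /(_ n) h; lra.
  have ki' : (k < i.+1)%N.
    by rewrite ltnNge; apply/negP => /rmono - /(_ n) h; lra.
  by move/negP : ik; apply; apply/eqP/val_inj => /=; apply/eqP; rewrite eqn_leq -ltnS ik' -ltnS ki'.
rewrite indicE mem_set// scale1r.
move: At; rewrite /A /= in_itv/= => /andP[h3 h4].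
rewrite (le_trans (fL _ _ _ _))//.
- by rewrite rp (le_lt_trans h3 tq).
- by rewrite pt tq.
rewrite -mulrA ler_wpM2l// distrC ger0_norm ?subr_ge0//.
have rk : r n k.+1 = r n k + (q - p) / n.+1%:R.
  by rewrite /r -[k.+1%:R]natr1 [(_ + 1) / _]mulrDl mulrDr div1r addrA.
by rewrite lerBlDr addrC -rk ltW.
Qed.

End lipschitz_measurable.

(** * Smooth bump functions *)

Section bump.
Context {R : realType}.

(** The functions x^(-n) exp(-1/x), extended by 0 to x <= 0.  Up to linear
combinations the family is closed under differentiation, which makes the
smoothness of each member an induction. *)
Definition flat (n : nat) (x : R) : R :=
  if 0 < x then x^-1 ^+ n * expR (- x^-1) else 0.

(** The quadratic bound at 0 comes from the term of degree n + 2 of the series of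
exp(1/x); it yields the derivative 0 at 0. *)
Lemma flat_le n (x : R) : `|flat n x| <= (n.+2)`!%:R * x ^+ 2.
Proof.
rewrite /flat; case: ifPn => [x0|_]; last by rewrite normr0 mulr_ge0// sqr_ge0.
have y0 : 0 < x^-1 by rewrite invr_gt0.
rewrite ger0_norm; last by rewrite mulr_ge0 ?expR_ge0 ?exprn_ge0// ltW.
rewrite expRN ler_pdivrMr ?expR_gt0//.
have h := expR_ge1Dxn n.+1 (ltW y0).
have f0 : 0 < (n.+2)`!%:R :> R by rewrite ltr0n fact_gt0.
have h2 : x^-1 ^+ n.+2 <= (n.+2)`!%:R * expR x^-1.
  by rewrite mulrC -ler_pdivrMr//; lra.
have -> : x^-1 ^+ n = x^-1 ^+ n.+2 * x ^+ 2.
  by rewrite !exprS; field; rewrite gt_eqF.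
by rewrite [leRHS]mulrAC ler_wpM2r ?sqr_ge0.
Qed.

Lemma is_derive_exprn (f : R -> R) n (x df : R) : is_derive x 1 f df ->
  is_derive x 1 (fun y => f y ^+ n) (n%:R * f x ^+ n.-1 * df).
Proof.
move=> fdf; have h := @is_deriveX R R^o f n x 1 df fdf.
rewrite (_ : (fun y => f y ^+ n) = f ^+ n)//.
by apply/funext => y; elim: n {h} => [|n IH]; rewrite ?expr0// !exprS IH.
Qed.

Lemma is_derive_flat n (x : R) :
  is_derive x 1 (flat n) (flat n.+2 x - n%:R * flat n.+1 x).
Proof.
have [x0|x0|->] := ltgtP x 0.
- have -> : flat n.+2 x - n%:R * flat n.+1 x = 0.
    by rewrite /flat !ltNge (ltW x0)/= mulr0 subr0.
  apply: (@near_eq_is_derive R R^o R^o (cst 0)).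
  near=> y; rewrite /flat ifF//; apply/negbTE; rewrite -leNgt ltW//.
  by near: y; exact: lt_nbhsl.
- apply: (@near_eq_is_derive R R^o R^o (fun x => x^-1 ^+ n * expR (- x^-1)) (flat n) x 1).
    near=> y; rewrite /flat ifT//.
    by near: y; exact: lt_nbhsr.
  have dV : is_derive x 1 (fun y : R => y^-1) (- x ^- 2).
    have := @is_deriveV R id x 1 1; rewrite gt_eqF// => /(_ isT) h.
    by apply: (is_derive_eq (h _)); rewrite scaler1.
  have dX : is_derive x 1 (fun y : R => y^-1 ^+ n) (n%:R * x^-1 ^+ n.-1 * - x ^- 2).
    exact: is_derive_exprn.
  have dE : is_derive x 1 (fun y : R => expR (- y^-1)) (expR (- x^-1) * (x ^- 2)).
    apply: (@is_derive1_comp R expR (fun y : R => - y^-1)).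
    by apply: is_derive_eq; rewrite opprK.
  apply: (is_derive_eq (@is_deriveM R R^o _ _ x 1 _ _ dX dE)).
  rewrite /flat x0 /GRing.scale/=.
  case: n {dX} => [|n]; first by rewrite !mul0r !expr0 exprS expr1 exprVn; ring.
  by rewrite /= !exprS; field; rewrite gt_eqF.
- rewrite /flat ltxx mulr0 subr0.
  suff h : h^-1 *: (flat n (h *: 1 + 0) - flat n 0) @[h --> 0^'] --> (0 : R).
    by apply: DeriveDef; [exact: cvgP h|exact/cvg_lim].
  apply/norm_cvg0P.
  apply: (@squeeze_cvgr _ _ _ _ (cst 0) (fun h : R => (n.+2)`!%:R * `|h|)).
  + near=> h; rewrite normr_ge0/= addr0.
    have h0 : h != 0 by near: h; exact: nbhs_dnbhs_neq.
    have -> : flat n 0 = 0 by rewrite /flat ltxx.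
    rewrite subr0 normrZ normfV ler_pdivrMl ?normr_gt0// [h *: 1]mulr1.
    rewrite (le_trans (flat_le n h))// [leRHS]mulrCA -normrM -expr2 ger0_norm ?sqr_ge0//.
  + exact: cvg_cst.
  + rewrite -[X in _ --> X](mulr0 (n.+2)`!%:R); apply: cvgMr.
    rewrite -[X in _ --> X](@normr0 _ R); apply: cvg_norm.
    exact: nbhs_dnbhs.
Unshelve. all: by end_near. Qed.

(** An algebra of functions, generated by flat functions at the two ends of [p, q],
that is stable under differentiation; all its members are thus smooth, and it
contains the product of a function flat at p and a function flat at q. *)
Inductive bump_algebra (p q : R) : (R -> R) -> Prop :=
| bump_left n : bump_algebra p q (fun t => flat n (t - p))
| bump_right n : bump_algebra p q (fun t => flat n (q - t))
| bump_linear a b f g : bump_algebra p q f -> bump_algebra p q g ->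
    bump_algebra p q (fun t => a * f t + b * g t)
| bump_mul f g : bump_algebra p q f -> bump_algebra p q g ->
    bump_algebra p q (fun t => f t * g t).

Lemma bump_algebra_derive p q f : bump_algebra p q f ->
  exists2 f', bump_algebra p q f' & forall t : R, is_derive t 1 f (f' t).
Proof.
elim=> {f} [n|n|a b f g _ [f' Sf f'E] _ [g' Sg g'E]|f g Sf [f' Sf' f'E] Sg [g' Sg' g'E]].
- exists (fun t => 1 * flat n.+2 (t - p) + (- n%:R) * flat n.+1 (t - p)).
    exact: bump_linear (bump_left _ _ _) (bump_left _ _ _).
  move=> t; apply: is_derive_eq.
    apply: (@is_derive1_comp R (flat n) (fun y : R => y - p)).
    exact: is_derive_flat.
  by rewrite subr0 mulr1 mul1r mulNr.
- exists (fun t => (- 1) * flat n.+2 (q - t) + n%:R * flat n.+1 (q - t)).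
    exact: bump_linear (bump_right _ _ _) (bump_right _ _ _).
  move=> t; apply: is_derive_eq.
    apply: (@is_derive1_comp R (flat n) (fun y : R => q - y)).
    exact: is_derive_flat.
  ring.
- exists (fun t => a * f' t + b * g' t); first exact: bump_linear.
  move=> t; have := f'E t; have := g'E t => dg df.
  have h1 : is_derive t 1 (fun t => a * f t) (a *: f' t) by exact: (@is_deriveZ R R^o R^o f a t 1 _ df).
  have h2 : is_derive t 1 (fun t => b * g t) (b *: g' t) by exact: (@is_deriveZ R R^o R^o g b t 1 _ dg).
  exact: (@is_deriveD R R^o R^o _ _ t 1 _ _ h1 h2).
- exists (fun t => 1 * (f' t * g t) + 1 * (f t * g' t)).
    by apply: bump_linear; exact: bump_mul.
  move=> t; apply: (is_derive_eq (@is_deriveM R R^o f g t 1 _ _ (f'E t) (g'E t))).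
  by rewrite /GRing.scale/=; ring.
Qed.

Lemma bump_algebra_smooth p q f : bump_algebra p q f ->
  forall k t, derivable (derive1n k f) t 1.
Proof.
move=> Sf k; have : bump_algebra p q (derive1n k f).
  elim: k => [|k IH] //; rewrite derive1nS.
  have [f' Sf' f'E] := bump_algebra_derive _ _ _ IH.
  rewrite (_ : _^`()%classic = f')//.
  by apply/funext => t; rewrite derive1E; exact: (@derive_val _ _ _ _ _ _ _ (f'E t)).
move=> /bump_algebra_derive[f' _ f'E] t.
exact: (@ex_derive _ _ _ _ _ _ _ (f'E t)).
Qed.

Lemma ex_bump (p q : R) : p < q -> exists phi : R -> R,
  [/\ forall k t, derivable (derive1n k phi) t 1,
      forall t, p < t < q -> 0 < phi t &
      forall t, ~~ (p < t < q) -> phi t = 0].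
Proof.
move=> pq; exists (fun t => flat 0 (t - p) * flat 0 (q - t)); split.
- apply: (@bump_algebra_smooth p q).
  by apply: bump_mul; [exact: bump_left|exact: bump_right].
- move=> t /andP[pt tq]; rewrite /flat !subr_gt0 pt tq.
  by rewrite !expr0 !mul1r mulr_gt0// expR_gt0.
- move=> t; rewrite negb_and /flat !subr_gt0 => /orP[/negbTE->|/negbTE->].
    by rewrite mul0r.
  by rewrite mulr0.
Qed.

End bump.

(** * Distributions with zero derivative *)

Section fundamental_lemma.
Context {R : realType}.
Local Notation lambda := (@lebesgue_measure R).

Lemma within_derivable_continuous (f : R -> R) (p q : R) :
  (forall t, p <= t <= q -> derivable f t 1) -> {within `[p, q], continuous f}.
Proof.
move=> df; apply: derivable_within_continuous => t.
by rewrite in_itv/= => tpq; exact: df.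
Qed.

(** The regularity at the ends that integration by parts and the fundamental theorem
of calculus ask for. *)
Lemma derivable_oo_LR (f : R -> R) (p q : R) : p < q ->
  (forall t, p <= t <= q -> derivable f t 1) -> derivable_oo_LRcontinuous f p q.
Proof.
move=> pq df; split.
- by move=> t; rewrite in_itv/= => /andP[pt tq]; apply: df; rewrite !ltW.
- apply: cvg_at_right_filter; apply: differentiable_continuous.
  by apply/derivable1_diffP; apply: df; rewrite lexx ltW.
- apply: cvg_at_left_filter; apply: differentiable_continuous.
  by apply/derivable1_diffP; apply: df; rewrite lexx ltW.
Qed.

(** If h were positive at some point, it would be positive on an interval [p, q]
around it.  For a bump phi on that interval, integration by parts gives
int h phi = - int phi' H = 0, against the positivity of h phi. *)
Lemma fundamental_lemma_le (a T : R) (H h : R -> R) :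
  (forall t, a < t < T -> is_derive t 1 H (h t)) ->
  (forall t, a < t < T -> derivable h t 1) ->
  (forall (p q : R) (phi : R -> R), a < p -> p < q -> q < T ->
     (forall k t, derivable (derive1n k phi) t 1) ->
     (forall t, ~~ (p < t < q) -> phi t = 0) ->
     \int[lambda]_(t in `[p, q]) (derive1 phi (t : R) * H t) = 0) ->
  forall t, a < t < T -> h t <= 0.
Proof.
move=> dH dh Hphi t0 /andP[at0 t0T]; rewrite leNgt; apply/negP => ht0.
have ch : {for t0, continuous h}.
  apply: differentiable_continuous; apply/derivable1_diffP.
  by apply: dh; rewrite at0.
have [p [q [ap pt tq qT hpos]]] : exists p q, [/\ a < p, p < t0, t0 < q, q < T &
    forall t, p <= t <= q -> 0 < h t].
  have : \forall t \near t0, 0 < h t by exact: (cvgr_gt _ ch _ ht0).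
  move=> /nbhs_ballP[e /= e0 he].
  pose r := Num.min (e / 2) (Num.min ((t0 - a) / 2) ((T - t0) / 2)).
  have r0 : 0 < r by rewrite !lt_min !divr_gt0 ?subr_gt0.
  have re : r <= e / 2 by rewrite ge_min lexx.
  have ra : r <= (t0 - a) / 2 by rewrite !ge_min lexx orbT.
  have rT : r <= (T - t0) / 2 by rewrite !ge_min lexx !orbT.
  exists (t0 - r), (t0 + r); split; [lra..|].
  by move=> t /andP[h1 h2]; apply: he; rewrite /ball/= ltr_norml; lra.
have pq : p < q by exact: lt_trans tq.
have [phi [sphi phi0 phiN]] := ex_bump p q pq.
have dphi t : derivable phi t 1 by exact: (sphi 0%N).
have dphi' t : derivable (derive1 phi) t 1 by exact: (sphi 1%N).
have inT t : p <= t <= q -> a < t < T.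
  by move=> /andP[h1 h2]; rewrite (lt_le_trans ap h1) (le_lt_trans h2 qT).
have HD t : p <= t <= q -> derivable H t 1.
  by move=> /inT/dH h1; exact: (@ex_derive _ _ _ _ _ _ _ h1).
have := Hphi p q phi ap pq qT sphi phiN.
have ibp := @Rintegration_by_parts R H phi h (derive1 phi) p q pq.
have -> : \int[lambda]_(t in `[p, q]) (derive1 phi (t : R) * H t) =
    \int[lambda]_(t in `[p, q]) (H t * derive1 phi t).
  by apply: eq_Rintegral => t _; rewrite mulrC.
have cpq : {within `[p, q], continuous h}.
  by apply: within_derivable_continuous => t /inT; exact: dh.
have HE : {in `]p, q[, (derive1 H) =1 h}.
  move=> t; rewrite in_itv/= => /andP[pt' tq'].
  have h1 : is_derive t 1 H (h t) by apply: dH; apply: inT; rewrite !ltW.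
  by rewrite derive1E; exact: (@derive_val _ _ _ _ _ _ _ h1).
have cphi' : {within `[p, q], continuous (derive1 phi)}.
  by apply: within_derivable_continuous => t _; exact: dphi'.
have ophi : derivable_oo_LRcontinuous phi p q by exact: derivable_oo_LR.
rewrite (ibp cpq (derivable_oo_LR _ _ _ pq HD) HE cphi' ophi (fun _ _ => erefl)).
rewrite !phiN ?ltxx ?andbF// !mulr0 subrr sub0r => /eqP; rewrite oppr_eq0 => /eqP I0.
have cphih : {within `[p, q], continuous (fun t => h t * phi t)}.
  apply: within_derivable_continuous => t /inT/dh dht.
  exact: (@derivableM R R^o h phi t 1 dht (dphi t)).
have iphih : lambda.-integrable `[p, q] (EFin \o (fun t => h t * phi t)).
  by apply: continuous_compact_integrable => //; exact: segment_compact.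
have ge0 t : p <= t <= q -> 0 <= h t * phi t.
  move=> tpq; rewrite mulr_ge0 ?(ltW (hpos t tpq))//.
  by have [/phi0/ltW//|/phiN->] := boolP (p < t < q).
have mphih := (integrableP _ _ _ iphih).1.
have [N [mN N0 sN]] : ae_eq lambda (`[p, q]%classic : set R) (EFin \o (fun t => h t * phi t)) (cst 0%E).
  apply/(ae_eq_integral_abs _ _ mphih) => //.
  transitivity (\int[lambda]_(t in `[p, q]) (h t * phi t)%:E)%E.
    by apply: eq_integral => t; rewrite inE/= in_itv/= => tpq; rewrite ger0_norm// ge0.
  rewrite -[LHS]fineK; last by apply: integrable_fin_num.
  by congr EFin.
have sub : `]p, q[ `<=` N.
  move=> t /=; rewrite in_itv/= => tpq; apply: sN => /= h0.
  have /andP[pt1 tq1] := tpq.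
  have tpq' : p <= t <= q by rewrite !ltW.
  have : 0 < h t * phi t by rewrite mulr_gt0// ?hpos// phi0.
  have := h0; rewrite in_itv/= => /(_ tpq')[->]; by rewrite ltxx.
have mpq : measurable (`]p, q[ : set R) by exact: measurable_itv.
have := @le_measure _ _ _ lambda _ _ (mem_set mpq) (mem_set mN) sub.
rewrite [X in (_ <= X)%E -> _]N0 [X in (X <= _)%E -> _]lebesgue_measure_itv/=.
by rewrite lte_fin pq -EFinD lee_fin subr_le0 leNgt pq.
Qed.

Lemma fundamental_lemma (a T : R) (H h : R -> R) :
  (forall t, a < t < T -> is_derive t 1 H (h t)) ->
  (forall t, a < t < T -> derivable h t 1) ->
  (forall (p q : R) (phi : R -> R), a < p -> p < q -> q < T ->
     (forall k t, derivable (derive1n k phi) t 1) ->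
     (forall t, ~~ (p < t < q) -> phi t = 0) ->
     \int[lambda]_(t in `[p, q]) (derive1 phi (t : R) * H t) = 0) ->
  forall t, a < t < T -> h t = 0.
Proof.
move=> dH dh Hphi t tT; apply/eqP; rewrite eq_le; apply/andP; split.
  exact: (@fundamental_lemma_le a T H h).
rewrite -oppr_le0; apply: (@fundamental_lemma_le a T (fun t => - H t) (fun t => - h t)); last exact: tT.
- by move=> x /dH dHx; exact: is_deriveN.
- by move=> x /dh dhx; exact: derivableN.
move=> p q phi ap pq qT sphi phi0.
have cH : {within `[p, q], continuous H}.
  apply: within_derivable_continuous => x /andP[px xq].
  have h1 : is_derive x 1 H (h x).
    by apply: dH; rewrite (lt_le_trans ap px) (le_lt_trans xq qT).
  exact: (@ex_derive _ _ _ _ _ _ _ h1).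
have i1 : lambda.-integrable `[p, q] (EFin \o (fun t => derive1 phi t * H t)).
  apply: continuous_compact_integrable; first exact: segment_compact.
  have c1 : {within `[p, q], continuous (derive1 phi)}.
    by apply: within_derivable_continuous => x _; exact: (sphi 1%N).
  move=> x; apply: cvgM; [exact: c1|exact: cH].
under eq_Rintegral do rewrite mulrN -mulN1r.
by rewrite RintegralZl// Hphi// mulr0.
Qed.

End fundamental_lemma.

(** * Power kernels and the derivatives of the fractional integral *)

Section kernel.
Context {R : realType}.
Local Notation lambda := (@lebesgue_measure R).

Lemma powR_le_npow (e x y : R) : e <= 0 -> 0 < y -> y <= x -> x `^ e <= y `^ e.
Proof.
move=> e0 y0 yx; have x0 : 0 < x by exact: lt_le_trans yx.
rewrite -(opprK e) [x `^ _]powRN [y `^ _]powRN lef_pV2 ?posrE ?powR_gt0//.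
by apply: ge0_ler_powR; rewrite ?nnegrE ?oppr_ge0// ltW.
Qed.

Lemma integrable_boundedM (D : set R) (k u : R -> R) (C : R) : measurable D ->
  measurable_fun D k -> (forall s, D s -> `|k s| <= C) ->
  lambda.-integrable D (EFin \o u) ->
  lambda.-integrable D (fun s : R => (k s * u s)%:E).
Proof.
move=> mD mk kC iu.
have iC : lambda.-integrable D (fun s : R => (C%:E * (u s)%:E)%E).
  exact: integrableZl.
have mu' : measurable_fun D u by apply/measurable_EFinP; exact: (integrableP _ _ _ iu).1.
apply: le_integrable iC => //.
  have h : measurable_fun D (fun s => k s * u s) by exact: measurable_funM.
  exact/measurable_EFinP.
move=> s Ds /=; rewrite lee_fin !normrM ler_wpM2r// (le_trans (kC s Ds))//.
exact: ler_norm.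
Qed.

Lemma measurable_subr_powR (D : set R) (t e : R) :
  measurable_fun D (fun s => (t - s) `^ e).
Proof.
apply: (@measurableT_comp _ _ _ _ _ _ (@powR R ^~ e)) => //.
exact: measurable_funB.
Qed.

Lemma integrable_kernel (a : R) (u : R -> R) (t e : R) : a < t -> e <= 0 ->
  lambda.-integrable `]0, a[ (EFin \o u) ->
  lambda.-integrable `]0, a[ (fun s : R => ((t - s) `^ e * u s)%:E).
Proof.
move=> at_ e0 iu; apply: (@integrable_boundedM _ _ _ ((t - a) `^ e)) => //.
  exact: measurable_subr_powR.
move=> s /=; rewrite in_itv/= => /andP[_ sa].
by rewrite ger0_norm ?powR_ge0// powR_le_npow ?subr_gt0//; lra.
Qed.

(** The integral over the past only, so that the kernel is bounded for t > a. *)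
Definition kernel_integral (a : R) (u : R -> R) (e t : R) : R :=
  \int[lambda]_(s in `]0, a[) ((t - s) `^ e * u s).

(** Differentiation under the integral: near t the kernel and its derivative are
bounded on (0, a), because t - s stays away from 0. *)
Lemma is_derive_kernel_integral (a : R) (u : R -> R) (e t : R) : a < t -> e <= 0 ->
  lambda.-integrable `]0, a[ (EFin \o u) ->
  is_derive t 1 (kernel_integral a u e) (e * kernel_integral a u (e - 1) t).
Proof.
move=> at_ e0 iu.
(* A neighborhood ]u0, v0[ of t at positive distance from a. *)
pose u0 := (a + t) / 2; pose v0 := t + 1.
have au0 : a < u0 by rewrite /u0; lra.
have It : `]u0, v0[%classic t by rewrite /= in_itv/= /u0 /v0; apply/andP; split; lra.
pose f (x s : R) := (x - s) `^ e * u s.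
have df x s : u0 < x -> s < a ->
    is_derive x 1 (f ^~ s) (e * (x - s) `^ (e - 1) * u s).
  move=> ux sa; have xs0 : 0 < x - s by lra.
  have d1 : is_derive x 1 (fun x => (x - s) `^ e) (e * (x - s) `^ (e - 1)).
    apply: is_derive_eq.
      apply: (@is_derive1_comp R (@powR R ^~ e) (fun y : R => y - s)).
      exact: is_derive1_powR.
    by rewrite subr0 mulr1.
  have d2 := @is_deriveM R R^o (fun x => (x - s) `^ e) (cst (u s)) x 1 _ _ d1
    (is_derive_cst _ _ _).
  apply: (is_derive_eq d2).
  by rewrite scaler0 add0r /GRing.scale/= mulrC.
have partE x s : u0 < x -> s < a -> partial1of2 f x s = e * (x - s) `^ (e - 1) * u s.
  move=> ux sa; rewrite partial1of2E.
  exact: (@derive_val _ _ _ _ _ _ _ (df x s ux sa)).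
pose G s := `|e| * (u0 - a) `^ (e - 1) * `|u s|.
have intf x : `]u0, v0[%classic x -> lambda.-integrable `]0, a[ (EFin \o f x).
  rewrite /= in_itv/= => /andP[ux _]; apply: integrable_kernel => //.
  exact: lt_trans ux.
have derf1 x s : `]u0, v0[%classic x -> `]0, a[%classic s -> derivable (f ^~ s) x 1.
  rewrite /= !in_itv/= => /andP[ux _] /andP[_ sa].
  exact: (@ex_derive _ _ _ _ _ _ _ (df x s ux sa)).
have G0 s : 0 <= G s by rewrite /G !mulr_ge0 ?powR_ge0.
have iG : lambda.-integrable `]0, a[ (EFin \o G).
  have h : lambda.-integrable `]0, a[ (EFin \o (Num.norm \o u)) by exact: integrable_norm.
  have : lambda.-integrable `]0, a[
    (fun s : R => ((`|e| * (u0 - a) `^ (e - 1))%:E * (`|u s|)%:E)%E).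
    exact: integrableZl.
  by [].
have Gub x s : `]u0, v0[%classic x -> `]0, a[%classic s -> `|partial1of2 f x s| <= G s.
  rewrite /= !in_itv/= => /andP[ux _] /andP[_ sa].
  rewrite partE// !normrM /G ler_wpM2r// ler_wpM2l//.
  by rewrite ger0_norm ?powR_ge0// powR_le_npow//; lra.
have mI : measurable (`]0, a[ : set R) by exact: measurable_itv.
apply: DeriveDef.
  exact: (@derivable_under_integral R _ _ lambda f _ mI t u0 v0 It intf derf1 G G0 iG Gub).
rewrite -derive1E.
rewrite (@differentiation_under_integral R _ _ lambda f _ mI t u0 v0 It intf derf1 G G0 iG Gub).
rewrite /kernel_integral -RintegralZl//; last first.
  by apply: integrable_kernel => //; lra.
apply: eq_Rintegral => s; rewrite inE/= in_itv/= => /andP[_ sa].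
have ut : u0 < t by rewrite /u0; lra.
by rewrite /= partE// mulrA.
Qed.

(** For b > 0 the second term is b times the integral of (t - s)^(-b-1) c over s < 0,
so this is the integral over the whole past of a function that is equal to c
before time 0. *)
Definition memory (a c : R) (u : R -> R) (b t : R) : R :=
  b * kernel_integral a u (- b - 1) t + c * t `^ (- b).

Lemma is_derive_memory (a c : R) (u : R -> R) (b t : R) : 0 <= a -> a < t -> -1 <= b ->
  lambda.-integrable `]0, a[ (EFin \o u) ->
  is_derive t 1 (memory a c u b) (- b * memory a c u (b + 1) t).
Proof.
move=> a0 at_ b1 iu.
have d1 : is_derive t 1 (kernel_integral a u (- b - 1))
    ((- b - 1) * kernel_integral a u (- b - 1 - 1) t).
  by apply: is_derive_kernel_integral => //; lra.
have d2 : is_derive t 1 (@powR R ^~ (- b)) (- b * t `^ (- b - 1)).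
  by apply: is_derive1_powR; exact: le_lt_trans at_.
have d3 := @is_deriveZ R R^o R^o _ b t 1 _ d1.
have d4 := @is_deriveZ R R^o R^o _ c t 1 _ d2.
have d5 := @is_deriveD R R^o R^o _ _ t 1 _ _ d3 d4.
apply: (is_derive_eq d5).
rewrite /memory /GRing.scale/= (_ : - (b + 1) - 1 = - b - 1 - 1); last by ring.
by rewrite (_ : - (b + 1) = - b - 1); last ring; ring.
Qed.

Lemma memory_zero_succ (a c T : R) (u : R -> R) (b : R) : 0 <= a -> -1 <= b -> b != 0 ->
  lambda.-integrable `]0, a[ (EFin \o u) ->
  (forall t, a < t < T -> memory a c u b t = 0) ->
  forall t, a < t < T -> memory a c u (b + 1) t = 0.
Proof.
move=> a0 b1 bn0 iu K0 t /andP[at_ tT].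
have d1 := is_derive_memory a c u b t a0 at_ b1 iu.
have d2 : is_derive t 1 (memory a c u b) 0.
  apply: (@near_eq_is_derive R R^o R^o (cst 0) (memory a c u b) t 1 0).
    near=> x; rewrite K0//; apply/andP; split.
      by near: x; exact: lt_nbhsr.
    by near: x; exact: lt_nbhsl.
  have e1 := @derive_val _ _ _ _ _ _ _ d1.
  have e2 := @derive_val _ _ _ _ _ _ _ d2.
  move: e1; rewrite e2 => /esym/eqP; rewrite mulf_eq0 oppr_eq0 (negbTE bn0)/=.
  by move=> /eqP.
Unshelve. all: by end_near. Qed.

(** Successive differentiation; no factor alpha + j vanishes. *)
Lemma memory_zero_all (a c T alpha : R) (u : R -> R) : 0 <= a -> 0 < alpha ->
  lambda.-integrable `]0, a[ (EFin \o u) ->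
  (forall t, a < t < T -> memory a c u alpha t = 0) ->
  forall (j : nat) t, a < t < T -> memory a c u (alpha + j%:R) t = 0.
Proof.
move=> a0 al0 iu K0; elim=> [|j IH]; first by rewrite addr0.
rewrite -natr1 addrA; apply: memory_zero_succ => //.
  by rewrite (@le_trans _ _ 0)// ?addr_ge0// ltW.
by rewrite gt_eqF// ltr_wpDr.
Qed.

Lemma memory_le (a c : R) (u : R -> R) (alpha p t U : R) : 0 <= a -> a < p -> p <= t ->
  0 <= alpha -> lambda.-integrable `]0, a[ (EFin \o u) ->
  \int[lambda]_(s in `]0, a[) `|u s| <= U ->
  `|memory a c u alpha t| <= alpha * (p - a) `^ (- alpha - 1) * U + `|c| * p `^ (- alpha).
Proof.
move=> a0 ap pt al0 iu uU; rewrite /memory (le_trans (ler_normD _ _))// lerD//.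
  rewrite normrM ger0_norm// -mulrA ler_wpM2l// /kernel_integral.
  have ik : lambda.-integrable `]0, a[ (EFin \o (fun s : R => (t - s) `^ (- alpha - 1) * u s)).
    by apply: integrable_kernel; [exact: lt_le_trans pt|lra|exact: iu].
  rewrite (le_trans (le_normr_Rintegral _ ik))//.
  have iau : lambda.-integrable `]0, a[ (EFin \o (Num.norm \o u)) by exact: integrable_norm.
  apply: (@le_trans _ _ (\int[lambda]_(s in `]0, a[) ((p - a) `^ (- alpha - 1) * `|u s|))).
    apply: le_Rintegral => //.
    - exact: (integrable_norm ik).
    - have : lambda.-integrable `]0, a[ (fun s : R => (((p - a) `^ (- alpha - 1))%:E * (`|u s|)%:E)%E).
        exact: integrableZl.
      by [].
    - move=> s; rewrite /= in_itv/= => /andP[s0 sa].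
      rewrite normrM ler_wpM2r// ger0_norm ?powR_ge0//.
      by apply: powR_le_npow; lra.
  rewrite RintegralZl//.
  by rewrite ler_wpM2l// powR_ge0.
rewrite normrM ler_wpM2l// ger0_norm ?powR_ge0//.
by apply: powR_le_npow; lra.
Qed.

(** The derivative is (1 - alpha) [memory a c u alpha], which [memory_le] bounds
uniformly for t >= p. *)
Lemma memory_lipschitz (a c : R) (u : R -> R) (alpha p U t t' : R) : 0 <= a -> a < p ->
  0 <= alpha <= 1 ->
  lambda.-integrable `]0, a[ (EFin \o u) ->
  \int[lambda]_(s in `]0, a[) `|u s| <= U -> p <= t -> p <= t' ->
  `|memory a c u (alpha - 1) t - memory a c u (alpha - 1) t'| <=
  (1 - alpha) * (alpha * (p - a) `^ (- alpha - 1) * U + `|c| * p `^ (- alpha)) * `|t - t'|.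
Proof.
move=> a0 ap /andP[al0 al1] iu uU.
wlog : t t' / t <= t'.
  move=> W pt pt'; have [tt'|/ltW t't] := leP t t'; first exact: W.
  by rewrite distrC (distrC t); exact: W.
rewrite le_eqVlt => /predU1P[-> _ _|tt' pt pt']; first by rewrite !subrr normr0 mulr0.
have dm x : t <= x -> is_derive x 1 (memory a c u (alpha - 1))
    (- (alpha - 1) * memory a c u alpha x).
  move=> tx; have := is_derive_memory a c u (alpha - 1) x a0.
  rewrite subrK; apply => //; last by lra.
  exact: lt_le_trans ap (le_trans pt tx).
have [||x xtt' E] := @MVT R (memory a c u (alpha - 1))
    (fun x => - (alpha - 1) * memory a c u alpha x) t t' tt'.
- by move=> x; rewrite in_itv/= => /andP[tx _]; apply: dm; exact: ltW.
- apply: within_derivable_continuous => x /andP[tx _].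
  exact: (@ex_derive _ _ _ _ _ _ _ (dm x tx)).
rewrite distrC E normrM (distrC t) ler_wpM2r// normrM.
have -> : `|- (alpha - 1)| = 1 - alpha by rewrite opprB ger0_norm// subr_ge0.
rewrite ler_wpM2l ?subr_ge0//.
apply: memory_le => //; move: xtt'; rewrite in_itv/= => /andP[tx _].
by rewrite (le_trans pt)// ltW.
Qed.

End kernel.

(** * Integrals of powers and the Gamma function *)

Section powR_integral.
Context {R : realType}.
Local Notation lambda := (@lebesgue_measure R).

Lemma integral_powR_cc (e p q : R) : -1 < e -> 0 < p -> p < q ->
  (\int[lambda]_(s in `[p, q]) (s `^ e)%:E =
    (q `^ (e + 1) / (e + 1) - p `^ (e + 1) / (e + 1))%:E)%E.
Proof.
move=> e1 p0 pq; have e10 : e + 1 != 0 by rewrite gt_eqF//; lra.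
have dF (x : R) : 0 < x -> is_derive x 1 (fun s => s `^ (e + 1) / (e + 1)) (x `^ e).
  move=> x0; have d1 := is_derive1_powR (e + 1) x0.
  have d2 := @is_deriveM R R^o (fun s => s `^ (e + 1)) (cst (e + 1)^-1) x 1 _ _ d1
    (is_derive_cst _ _ _).
  apply: (is_derive_eq d2).
  by rewrite scaler0 add0r /GRing.scale/= addrK mulrA mulVf// mul1r.
rewrite (@continuous_FTC2 R (@powR R ^~ e) (fun s => s `^ (e + 1) / (e + 1)))//.
- apply: within_derivable_continuous => t /andP[pt _].
  exact: (@ex_derive _ _ _ _ _ _ _ (is_derive1_powR e (lt_le_trans p0 pt))).
- apply: derivable_oo_LR => // t /andP[pt _].
  exact: (@ex_derive _ _ _ _ _ _ _ (dF t (lt_le_trans p0 pt))).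
move=> t; rewrite in_itv/= => /andP[pt _]; rewrite derive1E.
exact: (@derive_val _ _ _ _ _ _ _ (dF t (lt_trans p0 pt))).
Qed.

(** Monotone limit of the integrals over [1/(n+1), t], where the integrand is
continuous. *)
Lemma integral_powR_oc (e t : R) : -1 < e -> 0 < t ->
  (\int[lambda]_(s in `]0%R, t]) (s `^ e)%:E = (t `^ (e + 1) / (e + 1))%:E)%E.
Proof.
move=> e1 t0.
have mp : measurable_fun [set: R] (@powR R ^~ e) by exact: measurable_powR.
pose I n : set R := [set` Interval (BLeft (0 + n.+1%:R^-1)) (BRight t)].
have h1 : (\int[lambda]_(s in I n)
    (s `^ e)%:E)%E @[n --> \oo] --> (\int[lambda]_(s in `]0%R, t]) (s `^ e)%:E)%E.
  rewrite itv_open_bnd_bigcup -/(I _); apply: ge0_nondecreasing_set_cvg_integral.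
  - move=> m n mn; apply/subsetPset => x; rewrite /I /= !in_itv/= => /andP[h1 ->].
    rewrite andbT (le_trans _ h1)// lerD2l lef_pV2 ?posrE ?ltr0n//.
    by rewrite ler_nat.
  - by move=> i; exact: measurable_itv.
  - move=> i; apply/measurable_EFinP; apply: measurable_funTS; exact: mp.
  - by move=> i x _; rewrite lee_fin powR_ge0.
have h2 : (\int[lambda]_(s in I n)
    (s `^ e)%:E)%E @[n --> \oo] --> (t `^ (e + 1) / (e + 1) - 0)%:E.
  have hc : n.+1%:R^-1 @[n --> \oo] --> (0 : R) by exact: cvg_harmonic.
  have hs : t `^ (e + 1) / (e + 1) - n.+1%:R^-1 `^ (e + 1) / (e + 1) @[n --> \oo] -->
      t `^ (e + 1) / (e + 1) - 0.
    apply: cvgB; first exact: cvg_cst.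
    rewrite -[X in _ --> X](mul0r (e + 1)^-1); apply: cvgM; last exact: cvg_cst.
    have e10 : 0 < e + 1 by lra.
    have /cvg_at_rightP := powR_cvg0 e10; apply; split => // n.
  apply/fine_cvgP; split.
    have [N _ HN] := cvgr_lt _ hc _ t0; exists N => // n Nn; have nt := HN n Nn.
    by rewrite /I add0r integral_powR_cc// invr_gt0 ltr0n.
  apply: cvg_trans hs; apply: near_eq_cvg.
  have [N _ HN] := cvgr_lt _ hc _ t0; exists N => // n Nn; have nt := HN n Nn.
  move=> /=.
  by rewrite /I add0r integral_powR_cc// invr_gt0 ltr0n.
by rewrite (cvg_unique _ h1 h2) ?subr0.
Qed.

Lemma integral_powR_oo (e t : R) : -1 < e -> 0 < t ->
  (\int[lambda]_(s in `]0%R, t[) (s `^ e)%:E = (t `^ (e + 1) / (e + 1))%:E)%E.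
Proof.
move=> e1 t0; rewrite integral_itv_bndo_bndc ?integral_powR_oc//.
apply/measurable_EFinP; apply: measurable_funTS; exact: measurable_powR.
Qed.

Lemma integrable_powR_oo (e t : R) : -1 < e -> 0 < t ->
  lambda.-integrable `]0%R, t[ (fun s : R => (s `^ e)%:E).
Proof.
move=> e1 t0; apply/integrableP; split.
  apply/measurable_EFinP; apply: measurable_funTS; exact: measurable_powR.
under eq_integral do rewrite gee0_abs ?lee_fin ?powR_ge0//.
by rewrite integral_powR_oo// ltry.
Qed.

Lemma integral_subr_powR_cc (e t q : R) : -1 < e -> 0 < q -> q < t ->
  (\int[lambda]_(s in `[0%R, q]) ((t - s) `^ e)%:E =
    (t `^ (e + 1) / (e + 1) - (t - q) `^ (e + 1) / (e + 1))%:E)%E.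
Proof.
move=> e1 q0 qt; have e10 : e + 1 != 0 by rewrite gt_eqF//; lra.
have dF (x : R) : x < t ->
    is_derive x 1 (fun s => - ((t - s) `^ (e + 1) / (e + 1))) ((t - x) `^ e).
  move=> xt; have tx : 0 < t - x by lra.
  have d1 : is_derive x 1 (fun s => (t - s) `^ (e + 1)) (- ((e + 1) * (t - x) `^ (e + 1 - 1))).
    apply: is_derive_eq.
      apply: (@is_derive1_comp R (@powR R ^~ (e + 1)) (fun y : R => t - y)).
      exact: is_derive1_powR.
    by ring.
  have d2 := @is_deriveM R R^o (fun s => (t - s) `^ (e + 1)) (cst (e + 1)^-1) x 1 _ _ d1
    (is_derive_cst _ _ _).
  have d3 := @is_deriveN R R^o R^o _ x 1 _ d2.
  apply: (is_derive_eq d3).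
  by rewrite scaler0 add0r /GRing.scale/= addrK mulrN opprK mulrA mulVf// mul1r.
have cF (x : R) : x < t -> derivable (fun s => (t - s) `^ e) x 1.
  move=> xt; have tx : 0 < t - x by lra.
  have d1 : is_derive x 1 (fun s => (t - s) `^ e) (e * (t - x) `^ (e - 1) * (0 - 1)).
    apply: (@is_derive1_comp R (@powR R ^~ e) (fun y : R => t - y)).
    exact: is_derive1_powR.
  exact: (@ex_derive _ _ _ _ _ _ _ d1).
rewrite (@continuous_FTC2 R (fun s => (t - s) `^ e)
  (fun s => - ((t - s) `^ (e + 1) / (e + 1))))//.
- by rewrite subr0 -EFinB opprK addrC.
- by apply: within_derivable_continuous => x /andP[_ xq]; apply: cF; exact: le_lt_trans qt.
- apply: derivable_oo_LR => // x /andP[_ xq].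
  exact: (@ex_derive _ _ _ _ _ _ _ (dF x (le_lt_trans xq qt))).
move=> x; rewrite in_itv/= => /andP[_ xq]; rewrite derive1E.
exact: (@derive_val _ _ _ _ _ _ _ (dF x (lt_trans xq qt))).
Qed.

(** Monotone limit of the integrals over [0, t - 1/(n+1)], where the integrand is
continuous. *)
Lemma integral_subr_powR_oo (e t : R) : -1 < e -> 0 < t ->
  (\int[lambda]_(s in `]0%R, t[) ((t - s) `^ e)%:E = (t `^ (e + 1) / (e + 1))%:E)%E.
Proof.
move=> e1 t0.
have mp (A : set R) : measurable_fun A (fun s : R => ((t - s) `^ e)%:E).
  by apply/measurable_EFinP; exact: measurable_subr_powR.
rewrite integral_itv_obnd_cbnd//.
pose I n : set R := [set` Interval (BLeft 0) (BRight (t - n.+1%:R^-1))].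
have h1 : (\int[lambda]_(s in I n) ((t - s) `^ e)%:E)%E @[n --> \oo] -->
    (\int[lambda]_(s in `[0%R, t[) ((t - s) `^ e)%:E)%E.
  rewrite itv_bnd_open_bigcup -/(I _); apply: ge0_nondecreasing_set_cvg_integral.
  - move=> m n mn; apply/subsetPset => x; rewrite /I /= !in_itv/= => /andP[-> h1].
    rewrite /= (le_trans h1)// lerD2l lerN2 lef_pV2 ?posrE ?ltr0n//.
    by rewrite ler_nat.
  - by move=> i; exact: measurable_itv.
  - by move=> i; exact: mp.
  - by move=> i x _; rewrite lee_fin powR_ge0.
have hc : n.+1%:R^-1 @[n --> \oo] --> (0 : R) by exact: cvg_harmonic.
have h2 : (\int[lambda]_(s in I n) ((t - s) `^ e)%:E)%E @[n --> \oo] -->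
    (t `^ (e + 1) / (e + 1) - 0)%:E.
  have hs : t `^ (e + 1) / (e + 1) - n.+1%:R^-1 `^ (e + 1) / (e + 1) @[n --> \oo] -->
      t `^ (e + 1) / (e + 1) - 0.
    apply: cvgB; first exact: cvg_cst.
    rewrite -[X in _ --> X](mul0r (e + 1)^-1); apply: cvgM; last exact: cvg_cst.
    have e10 : 0 < e + 1 by lra.
    by have /cvg_at_rightP := powR_cvg0 e10; apply; split => // n.
  have IE n : n.+1%:R^-1 < t -> (\int[lambda]_(s in I n) ((t - s) `^ e)%:E)%E =
      (t `^ (e + 1) / (e + 1) - n.+1%:R^-1 `^ (e + 1) / (e + 1))%:E.
    move=> nt; have n0 : 0 < n.+1%:R^-1 :> R by rewrite invr_gt0 ltr0n.
    rewrite /I; move: (n.+1%:R^-1) nt n0 => i it i0.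
    by rewrite integral_subr_powR_cc ?subKr//; lra.
  have [N _ HN] := cvgr_lt _ hc _ t0.
  apply/fine_cvgP; split; first by exists N => // n Nn; rewrite IE//; exact: (HN n Nn).
  apply: cvg_trans hs; apply: near_eq_cvg.
  by exists N => // n Nn /=; rewrite IE//; exact: (HN n Nn).
by rewrite (cvg_unique _ h1 h2) ?subr0.
Qed.

Lemma integrable_subr_powR_oo (e t : R) : -1 < e -> 0 < t ->
  lambda.-integrable `]0%R, t[ (fun s : R => ((t - s) `^ e)%:E).
Proof.
move=> e1 t0; apply/integrableP; split.
  by apply/measurable_EFinP; exact: measurable_subr_powR.
under eq_integral do rewrite gee0_abs ?lee_fin ?powR_ge0//.
by rewrite integral_subr_powR_oo// ltry.
Qed.

(** The real-valued integral that defines Gamma would be 0 if the integral were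
infinite, and the fractional integral would then vanish identically; so
finiteness matters as much as positivity.  The integrand is at most t^(x-1) on
(0, 1] and at most exp(-t) beyond. *)
Lemma Gamma_gt0 (x : R) : 0 < x < 1 -> 0 < Gamma x.
Proof.
move=> /andP[x0 x1].
have mg : measurable_fun [set: R] (fun t : R => (t `^ (x - 1) * expR (- t))).
  apply: measurable_funM; first exact: measurable_powR.
  by apply: measurableT_comp => //; exact: measurable_funN.
have mg' (A : set R) : measurable_fun A (fun t : R => (t `^ (x - 1) * expR (- t))%:E).
  by apply/measurable_EFinP; apply: measurable_funTS.
have g0 (t : R) : (0 <= (t `^ (x - 1) * expR (- t))%:E)%E.
  by rewrite lee_fin mulr_ge0 ?powR_ge0 ?expR_ge0.
have split_itv : (`]0, +oo[%classic : set R) = `]0, 1] `|` `]1, +oo[.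
  apply/seteqP; split=> t /=; rewrite !in_itv/= !andbT.
    by move=> t0; case: (leP t 1) => h; [left; rewrite t0|right].
  by move=> [/andP[]//|t1]; lra.
have I1 : (\int[lambda]_(t in `]0%R, 1%R]) (t `^ (x - 1) * expR (- t))%:E < +oo)%E.
  apply: (@le_lt_trans _ _ (\int[lambda]_(t in `]0%R, 1%R]) (t `^ (x - 1))%:E)%E).
    apply: ge0_le_integral => //.
    - exact: mg'.
    - apply/measurable_EFinP; apply: measurable_funTS; exact: measurable_powR.
    - move=> t /=; rewrite in_itv/= => /andP[t0 _].
      by rewrite lee_fin ler_piMr ?powR_ge0// -expR0 ler_expR oppr_le0 ltW.
  by rewrite integral_powR_oc ?ltry//; lra.
have I2 : (\int[lambda]_(t in `]1%R, +oo[) (t `^ (x - 1) * expR (- t))%:E < +oo)%E.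
  apply: (@le_lt_trans _ _ (\int[lambda]_(t in `[1%R, +oo[) (expR (- t))%:E)%E).
    rewrite -integral_itv_obnd_cbnd//; last first.
      by apply/measurable_EFinP; apply: measurable_funTS;
        apply: measurableT_comp => //; exact: measurable_funN.
    apply: ge0_le_integral => //.
    - exact: mg'.
    - by apply/measurable_EFinP; apply: measurable_funTS;
        apply: measurableT_comp => //; exact: measurable_funN.
    - move=> t /=; rewrite in_itv/= andbT => t1.
      rewrite lee_fin ler_piMl ?expR_ge0//.
      have := @powR_le_npow R (x - 1) t 1; rewrite powR1; apply; lra.
  have dE' (t : R) : is_derive t 1 (fun s : R => expR (- s)) (- expR (- t)).
    by apply: is_derive_eq; rewrite mulrN1.
  have cE (t : R) : {for t, continuous (fun s : R => - expR (- s))}.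
    apply: differentiable_continuous; apply/derivable1_diffP.
    by apply: derivableN; exact: (@ex_derive _ _ _ _ _ _ _ (dE' t)).
  have dE (t : R) : is_derive t 1 (fun s : R => - expR (- s)) (expR (- t)).
    by apply: is_derive_eq; rewrite opprK.
  rewrite (@ge0_continuous_FTC2y R (fun t => expR (- t)) (fun s : R => - expR (- s)) 1 0).
  - by rewrite -EFinB ltry.
  - by move=> t _; exact: expR_ge0.
  - apply: continuous_subspaceT => t.
    apply: differentiable_continuous; apply/derivable1_diffP.
    exact: (@ex_derive _ _ _ _ _ _ _ (dE' t)).
  - rewrite -[X in _ --> X]oppr0; apply: cvgN; exact: cvgr_expR.
  - by move=> t _; exact: (@ex_derive _ _ _ _ _ _ _ (dE t)).
  - apply: cvg_at_right_filter; exact: (cE 1).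
  - move=> t _; rewrite derive1E.
    exact: (@derive_val _ _ _ _ _ _ _ (dE t)).
have fin : (\int[lambda]_(t in `]0%R, +oo[) (t `^ (x - 1) * expR (- t))%:E < +oo)%E.
  rewrite split_itv ge0_integral_setU//=.
  - by rewrite lte_add_pinfty.
  - exact: mg'.
  by apply/disj_setPS => t [] /=; rewrite !in_itv/= andbT => /andP[_ h1] /(le_lt_trans h1); rewrite ltxx.
rewrite /Gamma /Rintegral fine_gt0// fin andbT.
apply: (@lt_le_trans _ _ (\int[lambda]_(t in `]0%R, 1%R]) ((expR (-1))%:E * (t `^ (x - 1))%:E))%E).
  rewrite ge0_integralZl//=.
  - by rewrite integral_powR_oc; [rewrite -EFinM lte_fin powR1 subrK mulr_gt0 ?expR_gt0// divr_gt0|lra|].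
  - apply/measurable_EFinP; apply: measurable_funTS; exact: measurable_powR.
  - by move=> t _; rewrite lee_fin powR_ge0.
apply: (@le_trans _ _ (\int[lambda]_(t in `]0%R, 1%R]) (t `^ (x - 1) * expR (- t))%:E)%E).
  apply: ge0_le_integral => //.
  - by move=> t _; rewrite mule_ge0// lee_fin ?expR_ge0 ?powR_ge0.
  - apply/measurable_EFinP; apply: measurable_funTS; exact: measurable_funM.
  - exact: mg'.
  - move=> t /=; rewrite in_itv/= => /andP[t0 t1].
    by rewrite -EFinM lee_fin mulrC ler_wpM2l ?powR_ge0// ler_expR lerN2.
apply: ge0_subset_integral => //; first exact: mg'.
by rewrite split_itv; exact: subsetUl.
Qed.

End powR_integral.

(** * The moment problem *)

Section moments.
Context {R : realType}.
Local Notation lambda := (@lebesgue_measure R).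

Lemma bernoulli_ge (x : R) (m : nat) : -1 <= x -> 1 + m%:R * x <= (1 + x) ^+ m.
Proof.
move=> x1; elim: m => [|m IH]; first by rewrite mul0r addr0 expr0.
rewrite exprS; apply: (@le_trans _ _ ((1 + x) * (1 + m%:R * x))); last first.
  by rewrite ler_wpM2l//; lra.
rewrite -natr1; have : 0 <= m%:R * x ^+ 2 by rewrite mulr_ge0// sqr_ge0.
rewrite expr2; nra.
Qed.

(** The polynomials (1 - z^n)^(2^n) of the classical elementary proofs of the
Weierstrass theorem: on [0, 1] they converge to a step at z = 1/2. *)
Definition step_fun (z : R) (n : nat) : R := (1 - z ^+ n) ^+ (2 ^ n).

Lemma step_fun_bounds (z : R) n : 0 <= z <= 1 -> 0 <= step_fun z n <= 1.
Proof.
move=> /andP[z0 z1]; have h0 : 0 <= z ^+ n by rewrite exprn_ge0.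
have h1 : z ^+ n <= 1 by rewrite exprn_ile1.
by rewrite /step_fun exprn_ge0 ?subr_ge0// exprn_ile1 ?subr_ge0// gerBl.
Qed.

(** Bernoulli's inequality: (1 - z^n)^(2^n) >= 1 - (2 z)^n. *)
Lemma step_fun_cvg1 (z : R) : 0 <= z < 2^-1 -> step_fun z n @[n --> \oo] --> (1 : R).
Proof.
move=> /andP[z0 z1].
apply: (@squeeze_cvgr _ _ _ _ (fun n => 1 - (2 * z) ^+ n) (cst 1)).
- apply: nearW => n; have /andP[_ ->] := @step_fun_bounds z n ltac:(apply/andP; split; lra).
  rewrite andbT exprMn /step_fun.
  have := @bernoulli_ge (- z ^+ n) (2 ^ n)%N; rewrite natrX mulrN; apply.
  by rewrite lerN2 exprn_ile1//; lra.
- rewrite -[X in _ --> X]subr0; apply: cvgB; first exact: cvg_cst.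
  by apply: cvg_expr; rewrite ger0_norm; lra.
- exact: cvg_cst.
Qed.

(** (1 - z^n)^(2^n) (1 + z^n)^(2^n) <= 1, and the second factor is at least (2 z)^n by
Bernoulli's inequality. *)
Lemma step_fun_cvg0 (z : R) : 2^-1 < z <= 1 -> step_fun z n @[n --> \oo] --> (0 : R).
Proof.
move=> /andP[z0 z1]; have zp : 0 < z by lra.
apply: (@squeeze_cvgr _ _ _ _ (cst 0) (fun n => ((2 * z)^-1) ^+ n)).
- apply: nearW => n; have zb : 0 <= z <= 1 by apply/andP; split; lra.
  have /andP[-> _]/= := step_fun_bounds z n zb.
  have zn0 : 0 <= z ^+ n by rewrite exprn_ge0// ltW.
  have zn1 : z ^+ n <= 1 by rewrite exprn_ile1//; lra.
  rewrite exprVn -div1r ler_pdivlMr ?exprn_gt0//; last by lra.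
  apply: (@le_trans _ _ (step_fun z n * (1 + z ^+ n) ^+ (2 ^ n))).
    rewrite ler_wpM2l//; first by have /andP[] := step_fun_bounds z n zb.
    have := @bernoulli_ge (z ^+ n) (2 ^ n)%N; rewrite natrX exprMn => h.
    by apply: le_trans (h _); lra.
  rewrite /step_fun -exprMn (_ : _ * _ = 1 - (z ^+ n) ^+ 2); last by ring.
  have q0 : (z ^+ n) ^+ 2 <= 1 by rewrite exprn_ile1.
  have q1 : 0 <= (z ^+ n) ^+ 2 by rewrite sqr_ge0.
  by rewrite exprn_ile1//; lra.
- exact: cvg_cst.
- by apply: cvg_expr; rewrite ger0_norm ?invr_ge0 ?invf_lt1; lra.
Qed.

(** The affine change of variable sends y to (y - x) / (2 B) + 1/2, which lies in
[0, 1] for x, y in [0, B] and is 1/2 at y = x. *)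
Definition step_poly (B x : R) (n : nat) : {poly R} :=
  (1 - ((2 * B)^-1 *: ('X - x%:P) + (2^-1)%:P) ^+ n) ^+ (2 ^ n).

Lemma horner_step_poly (B x y : R) n :
  (step_poly B x n).[y] = step_fun ((y - x) / (2 * B) + 2^-1) n.
Proof.
rewrite /step_poly /step_fun !(hornerE, horner_exp).
by rewrite [_^-1 * _]mulrC.
Qed.

Lemma step_poly_bounds (B x y : R) n : 0 < B -> 0 <= x <= B -> 0 <= y <= B ->
  0 <= (step_poly B x n).[y] <= 1.
Proof.
move=> B0 /andP[x0 xB] /andP[y0 yB]; rewrite horner_step_poly; apply: step_fun_bounds.
have h1 : - 2^-1 <= (y - x) / (2 * B) by rewrite ler_pdivlMr; lra.
have h2 : (y - x) / (2 * B) <= 2^-1 by rewrite ler_pdivrMr; lra.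
by apply/andP; split; lra.
Qed.

Lemma step_poly_cvg (B x y : R) : 0 < B -> 0 <= x <= B -> 0 <= y <= B -> y != x ->
  (step_poly B x n).[y] @[n --> \oo] --> ((y < x)%R%:R : R).
Proof.
move=> B0 /andP[x0 xB] /andP[y0 yB] yx.
under eq_fun do rewrite horner_step_poly.
have [yltx|xlty|eqyx] := ltgtP y x; last by rewrite eqyx eqxx in yx.
- apply: step_fun_cvg1.
  have h1 : - 2^-1 <= (y - x) / (2 * B) by rewrite ler_pdivlMr; lra.
  have h2 : (y - x) / (2 * B) < 0 by rewrite ltr_pdivrMr; lra.
  by apply/andP; split; lra.
- apply: step_fun_cvg0.
  have h1 : 0 < (y - x) / (2 * B) by rewrite ltr_pdivlMr; lra.
  have h2 : (y - x) / (2 * B) <= 2^-1 by rewrite ler_pdivrMr; lra.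
  by apply/andP; split; lra.
Qed.

Lemma measurable_ltr_nat (D : set R) (Y : R -> R) (x : R) : measurable D ->
  measurable_fun D Y -> measurable_fun D (fun s : R => (Y s < x)%R%:R : R).
Proof.
move=> mD mY.
apply: (@eq_measurable_fun _ _ R R D (\1_(D `&` [set s | Y s < x]))).
  move=> s Ds; rewrite indicE in_setI Ds/=; congr (_%:R); congr nat_of_bool.
  by apply/idP/idP => [/set_mem|h]; [|apply/mem_set].
apply: measurable_indic.
have -> : D `&` [set s | Y s < x] = D `&` Y @^-1` `]-oo, x[.
  by apply/seteqP; split => s /= []; rewrite in_itv.
by apply: mY => //; exact: measurable_itv.
Qed.

Section pushed_moments.
Variables (D : set R) (Y psi : R -> R) (B : R).
Hypotheses (mD : measurable D) (mY : measurable_fun D Y) (B0 : 0 < B)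
  (YB : forall s, D s -> 0 <= Y s <= B)
  (ipsi : lambda.-integrable D (EFin \o psi)).

Lemma integrable_moment (i : nat) :
  lambda.-integrable D (fun s : R => (Y s ^+ i * psi s)%:E).
Proof.
apply: (@integrable_boundedM _ D (fun s => Y s ^+ i) psi (B ^+ i)) => //.
  exact: measurable_funX.
move=> s Ds; have /andP[Y0 Y1] := YB s Ds.
by rewrite ger0_norm ?exprn_ge0// lerXn2r ?nnegrE// ltW.
Qed.

Lemma Rintegral_poly (p : {poly R}) :
  lambda.-integrable D (fun s : R => (p.[Y s] * psi s)%:E) /\
  \int[lambda]_(s in D) (p.[Y s] * psi s) =
    \sum_(i < size p) p`_i * \int[lambda]_(s in D) (Y s ^+ i * psi s).
Proof.
have E s : p.[Y s] * psi s = \sum_(i < size p) p`_i * (Y s ^+ i * psi s).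
  by rewrite horner_coef mulr_suml; apply: eq_bigr => i _; rewrite mulrA.
have iF (i : 'I_(size p)) :
    lambda.-integrable D (EFin \o (fun s : R => p`_i * (Y s ^+ i * psi s))).
  have : lambda.-integrable D (fun s : R => ((p`_i)%:E * (Y s ^+ i * psi s)%:E)%E).
    by apply: integrableZl => //; exact: integrable_moment.
  by [].
have [h1 h2] := @Rintegral_sum_fin R D mD _ (index_enum _) _ iF.
split; first by under eq_fun do rewrite E.
under eq_Rintegral do rewrite E.
rewrite h2; apply: eq_bigr => i _.
by rewrite RintegralZl//; exact: integrable_moment.
Qed.

(** Dominated convergence, with |psi| as the dominating function. *)
Lemma step_poly_integral_cvg (x : R) : 0 <= x <= B ->
  {ae lambda, forall s, D s -> Y s != x} ->
  \int[lambda]_(s in D) ((step_poly B x n).[Y s] * psi s) @[n --> \oo] -->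
    \int[lambda]_(s in D) ((Y s < x)%R%:R * psi s).
Proof.
move=> xB Yx.
have mpsi : measurable_fun D psi by apply/measurable_EFinP; exact: (integrableP _ _ _ ipsi).1.
have [|||||i1 _ h] := @dominated_convergence _ _ _ lambda D mD
  (fun n (s : R) => ((step_poly B x n).[Y s] * psi s)%:E)
  (fun s : R => ((Y s < x)%R%:R * psi s)%:E)
  (fun s : R => (`|psi s|)%:E).
- by move=> n; exact: (integrableP _ _ _ (Rintegral_poly _).1).1.
- apply/measurable_EFinP; apply: measurable_funM => //.
  exact: measurable_ltr_nat.
- apply: (ae_imp _ _ _ Yx) => s Yxs Ds.
  apply/fine_cvgP; split; first exact: nearW.
  rewrite /comp /=; apply: cvgM; last exact: cvg_cst.
  by apply: step_poly_cvg => //; [exact: YB|exact: Yxs].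
- exact: integrable_norm.
- apply: aeW => s n Ds; rewrite lee_fin normrM ler_piMl//.
  have /andP[h0 h1] := step_poly_bounds B x (Y s) n B0 xB (YB s Ds).
  by rewrite ger0_norm.
pose J := (\int[lambda]_(s in D) ((Y s < x)%R%:R * psi s)%:E)%E.
have {}h : (fun n => \int[lambda]_(s in D) ((step_poly B x n).[Y s] * psi s)%:E)%E @ \oo -->
    (fine J)%:E.
  by rewrite fineK; [exact: h|apply: integrable_fin_num].
exact: (fine_cvg h).
Qed.

End pushed_moments.

(** Lebesgue differentiation of the primitive, which is identically 0. *)
Lemma ae_eq0_of_primitive (a : R) (psi : R -> R) :
  lambda.-integrable `]0, a[ (EFin \o psi) ->
  (forall x, 0 < x < a ->
    \int[lambda]_(s in `]0, a[) ((s < x)%R%:R * psi s) = 0) ->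
  {ae lambda, forall s, 0 < s < a -> psi s = 0}.
Proof.
move=> ipsi psi0.
pose D : set R := `]0, a[%classic.
have mD : measurable D by exact: measurable_itv.
pose f := psi \_ D.
have ifT : lambda.-integrable setT (EFin \o f).
  by have := ipsi; rewrite integrable_mkcond//= (restrict_EFin psi).
have locf : locally_integrable setT f by exact: integrable_locally.
have intf y : lambda.-integrable `]-oo, y] (EFin \o f).
  by apply: (integrableS measurableT) => //; exact: measurable_itv.
have := FTC1Ny intf locf; apply: ae_imp => x [dF F'x] /andP[x0 xa].
have F0 y : 0 < y < a -> \int[lambda]_(t in `]-oo, y]) f t = 0.
  move=> ya; rewrite -Rintegral_itv_bndo_bndc; last first.
    by apply: (integrableS measurableT) => //; exact: measurable_itv.
  rewrite -(psi0 y ya) Rintegral_mkcond [RHS]Rintegral_mkcond.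
  apply: eq_Rintegral => t _; rewrite /f !patchE.
  have -> : (t \in `]-oo, y[%classic) = (t < y).
    by apply/idP/idP => [/set_mem|h]; [|apply/mem_set]; rewrite /= in_itv.
  rewrite -/D; case: (t < y); rewrite ?mul1r// mul0r; by case: ifP.
have : derive1 (fun y : R => \int[lambda]_(t in `]-oo, y]) f t) x = 0.
  rewrite derive1E.
  have d0 : is_derive x 1 (fun y : R => \int[lambda]_(t in `]-oo, y]) f t) 0.
    apply: (@near_eq_is_derive R R^o R^o (cst 0) _ x 1 0).
    near=> y; rewrite F0//; apply/andP; split.
      by near: y; exact: lt_nbhsr.
    by near: y; exact: lt_nbhsl.
  exact: (@derive_val _ _ _ _ _ _ _ d0).
rewrite F'x /f patchE mem_set//.
by rewrite /D /= in_itv/= x0.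
Unshelve. all: by end_near. Qed.

(** In the variable Y = t0 / (t0 - s) the equation for j + 1 says that the j-th moment
of psi(s) = (t0 - s)^(-alpha-2) u(s), pushed forward to (1, B), is
C / (alpha + j + 1), where C is a multiple of c.  This is C times the j-th
moment of y^alpha on (0, 1).  Hence for every x the integral of psi over
the set where Y < x is C times the integral of y^alpha over the y < x in (0, 1).
For x = 1 the former is 0, so C = 0. *)
Lemma memory_moments (a c alpha t0 : R) (u : R -> R) : 0 < a -> a < t0 -> 0 < alpha ->
  lambda.-integrable `]0, a[ (EFin \o u) ->
  (forall j : nat, memory a c u (alpha + j%:R) t0 = 0) ->
  c = 0 /\ {ae lambda, forall s, 0 < s < a -> u s = 0}.
Proof.
move=> a0 at0 al0 iu K0.
have t00 : 0 < t0 by exact: lt_trans at0.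
pose D : set R := `]0, a[%classic.
have mD : measurable D by exact: measurable_itv.
pose E : set R := `]0, 1[%classic.
have mE : measurable E by exact: measurable_itv.
pose Y s := t0 / (t0 - s).
pose B := t0 / (t0 - a).
have DE s : D s -> 0 < s < a by rewrite /D /= in_itv.
have B1 : 1 < B by rewrite /B ltr_pdivlMr; lra.
have B0 : 0 < B by lra.
have Y1 s : D s -> 1 < Y s by move=> /DE/andP[s0 sa]; rewrite /Y ltr_pdivlMr; lra.
have YB s : D s -> 0 <= Y s <= B.
  move=> Ds; rewrite (le_trans ler01 (ltW (Y1 s Ds)))/=.
  have /andP[s0 sa] := DE s Ds.
  by rewrite /Y /B ler_pM2l// lef_pV2 ?posrE; lra.
have mY : measurable_fun D Y.
  apply: (@eq_measurable_fun _ _ R R D (fun s => t0 * (t0 - s) `^ (- 1))).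
    move=> s /set_mem/DE/andP[s0 sa]; rewrite /Y powR_inv1//; lra.
  by apply: measurable_funM => //; exact: measurable_subr_powR.
pose psi s := (t0 - s) `^ (- alpha - 2) * u s.
have ipsi : lambda.-integrable D (EFin \o psi).
  by apply: integrable_kernel => //; lra.
pose C := - c * t0 `^ (- alpha - 1).
have momD (j : nat) : \int[lambda]_(s in D) (Y s ^+ j * psi s) = C / (alpha + j.+1%:R).
  have := K0 j.+1; rewrite /memory.
  set b := alpha + j.+1%:R => Kb.
  have b0 : 0 < b by rewrite /b ltr_wpDr.
  have -> : \int[lambda]_(s in D) (Y s ^+ j * psi s) =
      t0 ^+ j * kernel_integral a u (- b - 1) t0.
    have hi : lambda.-integrable D (EFin \o (fun s : R => (t0 - s) `^ (- b - 1) * u s)).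
      by apply: integrable_kernel; [exact: at0|lra|exact: iu].
    rewrite /kernel_integral -/D -(@RintegralZl _ _ R lambda D _ (t0 ^+ j) mD hi).
    apply: eq_Rintegral => s /set_mem/DE/andP[s0 sa].
    have ts : 0 < t0 - s by lra.
    rewrite /Y /psi exprMn exprVn -!mulrA; congr (_ * _); rewrite mulrA; congr (_ * _).
    rewrite -powR_mulrn ?ltW// -powRN -powRD; last by apply/implyP => _; rewrite gt_eqF.
    by congr (_ `^ _); rewrite /b -natr1; ring.
  have -> : kernel_integral a u (- b - 1) t0 = - c * t0 `^ (- b) / b.
    by apply: (mulfI (lt0r_neq0 b0)); rewrite mulrCA mulfV ?gt_eqF// mulr1; lra.
  rewrite mulrA; congr (_ / _); rewrite mulrCA /C; congr (_ * _).
  rewrite -powR_mulrn ?ltW// -powRD; last by apply/implyP => _; rewrite gt_eqF.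
  by congr (_ `^ _); rewrite /b -natr1; ring.
have iE : lambda.-integrable E (EFin \o (@powR R ^~ alpha)).
  by apply: integrable_powR_oo => //; lra.
have EB s : E s -> 0 <= s <= B.
  by rewrite /E /= in_itv/= => /andP[s0 s1]; apply/andP; split; lra.
have mid : measurable_fun E (id : R -> R) by [].
have momE (j : nat) : \int[lambda]_(s in E) (s ^+ j * s `^ alpha) = (alpha + j.+1%:R)^-1.
  have -> : \int[lambda]_(s in E) (s ^+ j * s `^ alpha) =
      \int[lambda]_(s in E) (s `^ (alpha + j%:R)).
    apply: eq_Rintegral => s /set_mem; rewrite /E /= in_itv/= => /andP[s0 _].
    rewrite powRD; last by apply/implyP => _; rewrite gt_eqF.
    by rewrite powR_mulrn ?ltW// mulrC.
  rewrite /Rintegral integral_powR_oo//=.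
    by rewrite powR1 div1r -natr1 addrA.
  by have : 0 <= j%:R :> R by []; lra.
have key x : 0 <= x <= B -> {ae lambda, forall s, D s -> Y s != x} ->
    {ae lambda, forall s, E s -> s != x} ->
    \int[lambda]_(s in D) ((Y s < x)%R%:R * psi s) =
    C * \int[lambda]_(s in E) ((s < x)%R%:R * s `^ alpha).
  move=> xB aeD aeE.
  have h1 := @step_poly_integral_cvg D Y psi B mD mY B0 YB ipsi x xB aeD.
  have h2 := @step_poly_integral_cvg E id (@powR R ^~ alpha) B mE mid B0 EB iE x xB aeE.
  have h3 : C * \int[lambda]_(s in E) ((step_poly B x n).[s] * s `^ alpha) @[n --> \oo] -->
      C * \int[lambda]_(s in E) ((s < x)%R%:R * s `^ alpha) by apply: cvgMr.
  suff E12 : (fun n => \int[lambda]_(s in D) ((step_poly B x n).[Y s] * psi s)) =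
      (fun n => C * \int[lambda]_(s in E) ((step_poly B x n).[s] * s `^ alpha)).
    by rewrite E12 in h1; exact: (cvg_unique _ h1 h3).
  apply/funext => n.
  rewrite (@Rintegral_poly D Y psi B mD mY B0 YB ipsi _).2.
  rewrite (@Rintegral_poly E id (@powR R ^~ alpha) B mE mid B0 EB iE _).2.
  by rewrite mulr_sumr; apply: eq_bigr => i _; rewrite momD momE; ring.
(* At x = 1: Y > 1 on (0, a), so only the contribution of the history before time 0
   remains. *)
have C0 : C = 0.
  have := key 1; rewrite ler01 (ltW B1) => /(_ isT).
  have -> : \int[lambda]_(s in D) ((Y s < 1)%R%:R * psi s) = 0.
    transitivity (\int[lambda]_(s in D) (0 : R)); last by rewrite Rintegral_cst// mul0r.
    by apply: eq_Rintegral => s /set_mem Ds; rewrite ltNge (ltW (Y1 s Ds)) mul0r.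
  have -> : \int[lambda]_(s in E) ((s < 1)%R%:R * s `^ alpha) = (alpha + 1)^-1.
    rewrite -(momE 0%N); apply: eq_Rintegral => s /set_mem.
    by rewrite /E /= in_itv/= => /andP[_ ->]; rewrite expr0.
  move=> /(_ _ _)/esym h.
  have /eqP : C * (alpha + 1)^-1 = 0.
    apply: h; apply: aeW => s.
      by move=> Ds; rewrite gt_eqF// Y1.
    by rewrite /E /= in_itv/= => /andP[_ s1]; rewrite lt_eqF.
  rewrite mulf_eq0 invr_eq0 => /orP[/eqP//|/eqP]; lra.
split.
  move: C0 => /eqP; rewrite /C mulf_eq0 oppr_eq0 => /orP[/eqP//|].
  by rewrite gt_eqF// powR_gt0.
have : {ae lambda, forall s, 0 < s < a -> psi s = 0}.
  apply: ae_eq0_of_primitive => // x /andP[x0 xa].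
  have Yx s : D s -> (Y s < Y x) = (s < x).
    by move=> /DE/andP[s0 sa]; rewrite /Y ltr_pM2l// ltf_pV2 ?posrE; lra.
  have Dx : D x by rewrite /D /= in_itv/= x0.
  transitivity (\int[lambda]_(s in D) ((Y s < Y x)%R%:R * psi s)).
    by apply: eq_Rintegral => s /set_mem Ds; rewrite Yx.
  rewrite key ?C0 ?mul0r//; first exact: YB.
    exists [set x]; split => //; first exact: lebesgue_measure_set1.
    move=> s /= /not_implyP[Ds /negP]; rewrite negbK => /eqP YsYx.
    by move: YsYx; rewrite /Y => /(mulfI (lt0r_neq0 t00))/invr_inj; lra.
  apply: aeW => s; rewrite /E /= in_itv/= => /andP[_ s1].
  by rewrite lt_eqF// (lt_trans s1)// Y1.
apply: ae_imp => s h sa; have := h sa => /eqP; rewrite /psi mulf_eq0 => /orP[|/eqP//].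
by rewrite gt_eqF// powR_gt0; case/andP: sa => *; lra.
Qed.

End moments.

(** * Vanishing of the datum and of the history *)

Section unique_continuation.
Context {d : measure_display} {X : measurableType d} {R : realType}.
Variable mu : {measure set X -> \bar R}.
Local Notation lambda := (@lebesgue_measure R).
Local Notation nm := (nm mu).
Local Notation ip := (ip mu).
Local Notation smeas := (smeas mu).
Variables (alpha a T : R) (w wt : R -> L2 mu) (h : L2 mu).
Hypotheses (alpha01 : 0 < alpha < 1) (a0 : 0 < a) (aT : a < T).
Hypothesis swt : smeas `]0, T[ wt.
Hypothesis iwt : lambda.-integrable `]0, T[ (fun t : R => (nm (wt t))%:E).
Hypothesis wt0 : forall t, a <= t -> wt t = 0.
Hypothesis wwt : {ae lambda, forall t, 0 < t < T -> nm (w t - wt t) = 0}.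

Let u (psi : L2 mu) (s : R) : R := ip (wt s) psi.
Let F := frac_integral (1 - alpha) (fun t => w t - h).
Let K0 : R := ((alpha - 1) * Gamma (1 - alpha))^-1.
Let mem (psi : L2 mu) : R -> R -> R := memory a (ip h psi) (u psi).

Let G0 : 0 < Gamma (1 - alpha).
Proof. by have /andP[al0 al1] := alpha01; apply: Gamma_gt0; apply/andP; split; lra. Qed.
Let mI (p q : R) : measurable (`]p, q[%classic : set R).
Proof. exact: measurable_itv. Qed.

Let subT (t : R) : t <= T -> `]0, t[ `<=` `]0, T[.
Proof. by move=> tT s /=; rewrite !in_itv/= => /andP[-> st]; exact: lt_le_trans tT. Qed.

Let iwt_sub t : t <= T -> lambda.-integrable `]0, t[ (fun s : R => (nm (wt s))%:E).
Proof.
by move=> tT; apply: integrableS iwt => //; exact: subT.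
Qed.

Let iu_sub psi t : t <= T -> lambda.-integrable `]0, t[ (EFin \o u psi).
Proof.
move=> tT; apply: integrable_ip_smeas; [exact: mI| |exact: iwt_sub].
exact: smeas_sub (subT t tT) swt.
Qed.

Let integrable_kernel_past (v : R -> R) t : a < t -> t <= T ->
  lambda.-integrable `]0, t[ (EFin \o v) -> (forall s, a <= s -> v s = 0) ->
  lambda.-integrable `]0, t[ (fun s : R => ((t - s) `^ (1 - alpha - 1) * v s)%:E).
Proof.
have /andP[al0 al1] := alpha01; have a0' := a0; have aT' := aT; have Gp := G0.
move=> at_ tT iv v0.
pose k s : R := \1_(`]0, a[) s * (t - s) `^ (1 - alpha - 1).
have ik : lambda.-integrable `]0, t[ (fun s : R => (k s * v s)%:E).
  apply: (integrable_boundedM _ k v ((t - a) `^ (1 - alpha - 1)) _ _ _ iv).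
  - exact: mI.
  - apply: measurable_funM; last exact: measurable_subr_powR.
    by apply: measurable_indic; exact: mI.
  - move=> s _; rewrite /k indicE; have [/set_mem|_] := boolP (s \in _); last first.
      by rewrite mul0r normr0 powR_ge0.
    rewrite /= in_itv/= => /andP[s0 sa]; rewrite mul1r ger0_norm ?powR_ge0//.
    by apply: powR_le_npow; lra.
apply: eq_integrable ik => // s; rewrite inE/= in_itv/= => /andP[s0 st].
congr EFin; rewrite /k indicE; have [|nsa] := boolP (s \in _); first by rewrite mul1r.
rewrite v0 ?mulr0// leNgt; apply/negP => sa; move/negP : nsa; apply; apply/mem_set.
by rewrite /= in_itv/= s0.
Qed.

(** On (0, t) the integrand agrees almost everywhere with the kernel times [wt s - h],
which is strongly measurable with integrable norm: the kernel is bounded on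
the support of [wt], and integrable where it multiplies [h]. *)
Lemma frac_integral_pairing t psi : a < t < T -> ip (F t) psi = K0 * mem psi (alpha - 1) t.
Proof.
have /andP[al0 al1] := alpha01; have a0' := a0; have aT' := aT; have Gp := G0.
move=> /andP[at_ tT]; have t0 : 0 < t by exact: lt_trans at_.
pose D : set R := `]0, t[%classic.
have mD : measurable D by exact: mI.
pose k (s : R) : R := (t - s) `^ (1 - alpha - 1) / Gamma (1 - alpha).
have mk : measurable_fun D k.
  by apply: measurable_funM => //; exact: measurable_subr_powR.
have k0 s : 0 <= k s by rewrite /k divr_ge0 ?powR_ge0// ltW.
have fD : (lambda D < +oo)%E.
  by rewrite /D lebesgue_measure_itv/= lte_fin t0 -EFinB ltry.
have sD : smeas D wt by exact: smeas_sub (subT t (ltW tT)) swt.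
pose g s := k s *: (wt s - h).
have sg : smeas D g.
  by apply: smeasZ => //; apply: smeasB => //; exact: smeas_cst.
have ie : lambda.-integrable D (fun s : R => ((t - s) `^ (1 - alpha - 1))%:E).
  by apply: integrable_subr_powR_oo => //; lra.
have ik : lambda.-integrable D (fun s : R => (k s)%:E).
  have : lambda.-integrable D
    (fun s : R => (((t - s) `^ (1 - alpha - 1))%:E * ((Gamma (1 - alpha))^-1)%:E)%E).
    exact: integrableZr.
  by [].
have ikw : lambda.-integrable D
    (fun s : R => ((t - s) `^ (1 - alpha - 1) * nm (wt s))%:E).
  apply: (integrable_kernel_past (fun s => nm (wt s))) => //; first exact: ltW.
    by apply: iwt_sub; exact: ltW.
  by move=> s sa; rewrite wt0// nm0.
have ig : lambda.-integrable D (fun s : R => (nm (g s))%:E).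
  have i1 : lambda.-integrable D (fun s : R => (((Gamma (1 - alpha))^-1)%:E *
      ((t - s) `^ (1 - alpha - 1) * nm (wt s))%:E + (k s)%:E * (nm h)%:E)%E).
    by apply: integrableD => //; [exact: integrableZl|exact: integrableZr].
  apply: le_integrable i1 => //.
    have mg : measurable_fun D (fun s => nm (g s)) := measurable_smeas_nm mu D g sg.
    exact/measurable_EFinP.
  move=> s Ds; rewrite -!EFinM -EFinD /= lee_fin ger0_norm ?nm_ge0//.
  rewrite (le_trans _ (ler_norm _))// /g nmZ ger0_norm//.
  rewrite (le_trans (ler_wpM2l (k0 s) (nmB mu _ _)))// mulrDr lerD2r.
  by rewrite /k mulrA [_^-1 * _]mulrC.
have ae_fg : {ae lambda, forall s, D s -> nm (k s *: (w s - h) - g s) = 0}.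
  apply: (ae_imp _ _ _ wwt) => s ws; rewrite /D /= in_itv/= => /andP[s0 st].
  rewrite /g -scalerBr opprB addrA subrK nmZ ws ?mulr0//.
  by rewrite s0 (lt_trans st tT).
have := bochner_integral_pairing mu D (fun s => k s *: (w s - h)) g mD sg ig ae_fg psi.
rewrite -[bochner_integral _ _]/(F t) => ->.
have iu1 : lambda.-integrable D (EFin \o (fun s : R => (t - s) `^ (1 - alpha - 1) * u psi s)).
  apply: (integrable_kernel_past (u psi)) => //; first exact: ltW.
    by apply: iu_sub; exact: ltW.
  by move=> s sa; rewrite /u wt0// ip0l.
have -> : \int[lambda]_(s in D) ip (g s) psi =
    \int[lambda]_(s in D) ((Gamma (1 - alpha))^-1 * ((t - s) `^ (1 - alpha - 1) * u psi s) -
      (ip h psi / Gamma (1 - alpha)) * (t - s) `^ (1 - alpha - 1)).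
  by apply: eq_Rintegral => s _; rewrite /g ipZl ipBl /k -/(u psi s); ring.
rewrite RintegralB//; last 2 first.
- have : lambda.-integrable D (fun s : R => (((Gamma (1 - alpha))^-1)%:E *
      ((t - s) `^ (1 - alpha - 1) * u psi s)%:E)%E) by exact: integrableZl.
  by [].
- have : lambda.-integrable D (fun s : R => ((ip h psi / Gamma (1 - alpha))%:E *
      ((t - s) `^ (1 - alpha - 1))%:E)%E) by exact: integrableZl.
  by [].
rewrite (@RintegralZl _ _ R lambda D _ _ mD iu1) (@RintegralZl _ _ R lambda D _ _ mD ie).
have -> : \int[lambda]_(s in D) ((t - s) `^ (1 - alpha - 1)) = t `^ (1 - alpha) / (1 - alpha).
  rewrite /Rintegral integral_subr_powR_oo//=; last by lra.
  by rewrite (_ : 1 - alpha - 1 + 1 = 1 - alpha)//; ring.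
have -> : \int[lambda]_(s in D) ((t - s) `^ (1 - alpha - 1) * u psi s) =
    kernel_integral a (u psi) (- (alpha - 1) - 1) t.
  rewrite /kernel_integral Rintegral_mkcond [RHS]Rintegral_mkcond.
  apply: eq_Rintegral => s _; rewrite !patchE.
  have -> : (s \in D) = (0 < s < t).
    by apply/idP/idP => [/set_mem|hs]; [|apply/mem_set]; rewrite /D /= in_itv.
  have -> : (s \in `]0, a[%classic) = (0 < s < a).
    by apply/idP/idP => [/set_mem|hs]; [|apply/mem_set]; rewrite /= in_itv.
  rewrite (_ : - (alpha - 1) - 1 = 1 - alpha - 1); last by ring.
  have [sa|sa] := ltP s a; first by rewrite (lt_trans sa at_).
  by rewrite andbF /u wt0// ip0l mulr0; case: ifP.
rewrite /mem /memory /K0 (_ : - (alpha - 1) = 1 - alpha); last by ring.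
field; rewrite gt_eqF//=; apply/andP; split; apply/eqP; lra.
Qed.

Lemma pairing_L1_le psi :
  \int[lambda]_(s in `]0, a[) `|u psi s| <=
  (\int[lambda]_(s in `]0, a[) nm (wt s)) * nm psi.
Proof.
have iw := iwt_sub a (ltW aT).
have iu1 := iu_sub psi a (ltW aT).
rewrite -(@RintegralZr _ _ R lambda _ _ (nm psi) (mI 0 a) iw).
apply: le_Rintegral.
- exact: mI.
- exact: (integrable_norm iu1).
- have : lambda.-integrable `]0, a[ (fun s : R => ((nm (wt s))%:E * (nm psi)%:E)%E).
    by apply: integrableZr => //; exact: mI.
  by [].
- by move=> s _; exact: ip_le.
Qed.

(** By duality it is enough that the pairings with psi be Lipschitz with a constant
proportional to the norm of psi; this is [memory_lipschitz]. *)
Lemma frac_integral_lipschitz p : a < p -> exists2 L, 0 <= L &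
  forall t t', p <= t < T -> p <= t' < T -> nm (F t - F t') <= L * `|t - t'|.
Proof.
have /andP[al0 al1] := alpha01; have a0' := a0; have aT' := aT; have Gp := G0.
move=> ap; have p0 : 0 < p by exact: lt_trans ap.
pose W := \int[lambda]_(s in `]0, a[) nm (wt s).
have W0 : 0 <= W by apply: Rintegral_ge0 => s _; exact: nm_ge0.
pose L1 := (1 - alpha) * (alpha * (p - a) `^ (- alpha - 1) * W + nm h * p `^ (- alpha)).
have L10 : 0 <= L1.
  rewrite /L1 mulr_ge0//; first by lra.
  by rewrite addr_ge0// mulr_ge0 ?nm_ge0 ?powR_ge0// mulr_ge0 ?powR_ge0// ltW.
exists (`|K0| * L1); first by rewrite mulr_ge0.
move=> t t' /andP[pt tT] /andP[pt' t'T].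
apply: nm_le_pairing; first by apply: mulr_ge0 => //; exact: mulr_ge0.
move=> psi.
have atT : a < t < T by rewrite tT andbT (lt_le_trans ap).
have at'T : a < t' < T by rewrite t'T andbT (lt_le_trans ap).
have -> : ip (F t - F t') psi = K0 * (mem psi (alpha - 1) t - mem psi (alpha - 1) t').
  rewrite mulrBr; apply: etrans (ipBl mu (F t) (F t') psi) _.
  exact: (congr2 (fun x y => x - y) (frac_integral_pairing t psi atT)
    (frac_integral_pairing t' psi at'T)).
rewrite normrM.
have -> : `|K0| * L1 * `|t - t'| * nm psi = `|K0| * (L1 * nm psi * `|t - t'|) by ring.
apply: ler_wpM2l; first exact: normr_ge0.
have al01' : 0 <= alpha <= 1 by rewrite !ltW.
rewrite (le_trans (memory_lipschitz a (ip h psi) (u psi) alpha p _ t t' (ltW a0) ap al01'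
  (iu_sub psi a (ltW aT)) (pairing_L1_le psi) pt pt'))//.
apply: ler_wpM2r; first exact: normr_ge0.
have -> : L1 * nm psi = (1 - alpha) *
    ((alpha * (p - a) `^ (- alpha - 1) * W + nm h * p `^ (- alpha)) * nm psi).
  exact: esym (mulrA _ _ _).
apply: ler_wpM2l; first by rewrite subr_ge0 ltW.
rewrite mulrDl; apply: lerD; first by rewrite mulrA.
rewrite mulrAC; apply: ler_wpM2r; first exact: powR_ge0.
exact: ip_le.
Qed.

Hypothesis Dw : distribution_vanishes_on a T
  (RL_derivative T alpha (fun t => w t - h)).

(** The equation D_t^alpha (w - h) = 0 tested with phi and paired with psi.  On the
support of phi the function F is Lipschitz, so phi' F has a Bochner integral,
and the pairing can be taken inside. *)
Lemma test_integral_zero psi (p q : R) (phi : R -> R) : a < p -> p < q -> q < T ->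
  (forall k t, derivable (derive1n k phi) t 1) ->
  (forall t, ~~ (p < t < q) -> phi t = 0) ->
  \int[lambda]_(t in `[p, q]) (derive1 phi (t : R) * (K0 * mem psi (alpha - 1) t)) = 0.
Proof.
have /andP[al0 al1] := alpha01; have a0' := a0; have aT' := aT; have Gp := G0.
move=> ap pq qT sphi phi0.
have tphi : test_function a T phi.
  split => //; exists p, q; split => // t; apply: contraNT => tpq.
  apply/eqP/phi0; apply: contra tpq => /andP[h1 h2]; by rewrite !ltW.
have dphi t : derivable phi t 1 by exact: (sphi 0%N).
have dphi' t : derivable (derive1 phi) t 1 by exact: (sphi 1%N).
have phi'0 (t : R) : (t < p) || (q < t) -> derive1 phi t = 0.
  move=> tpq; rewrite derive1E.
  have d0 : is_derive t 1 phi 0.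
    apply: (@near_eq_is_derive R R^o R^o (cst 0) phi t 1 0).
    case/orP: tpq => [tp|qt].
      near=> y; rewrite phi0// negb_and -leNgt; apply/orP; left; apply: ltW.
      by near: y; exact: lt_nbhsl.
    near=> y; rewrite phi0// negb_and -!leNgt; apply/orP; right; apply: ltW.
    by near: y; exact: lt_nbhsr.
  exact: (@derive_val _ _ _ _ _ _ _ d0).
(* The Lipschitz version of F lives on [p, q2[ with q < q2 < T, so that it agrees with
   F on all of [p, q]. *)
pose q2 := (q + T) / 2.
have qq2 : q < q2 by rewrite /q2; lra.
have q2T : q2 < T by rewrite /q2; lra.
have [L L0 FL] := frac_integral_lipschitz p ap.
pose f t := derive1 phi t *: F t.
have fE : f = (fun t => derive1 phi t *: (\1_(`[p, q2[) t *: F t)).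
  apply/funext => t; rewrite /f indicE; have [|nt] := boolP (t \in _).
    by rewrite scale1r.
  rewrite phi'0 ?scale0r//; apply: contraNT nt; rewrite negb_or -!leNgt => /andP[h1 h2].
  by apply/mem_set; rewrite /= in_itv/= h1 (le_lt_trans h2).
pose D : set R := `]0, T[%classic.
have mD : measurable D by exact: mI.
have iphi : lambda.-integrable `[0, T] (EFin \o derive1 phi).
  apply: continuous_compact_integrable; first exact: segment_compact.
  by apply: within_derivable_continuous => t _; exact: dphi'.
have iphiD : lambda.-integrable D (EFin \o derive1 phi).
  apply: integrableS iphi => //.
  by move=> t /=; rewrite !in_itv/= => /andP[h1 h2]; rewrite !ltW.
have mphi : measurable_fun D (derive1 phi).
  by apply/measurable_EFinP; exact: (integrableP _ _ _ iphiD).1.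
have pq2 : p < q2 by exact: lt_trans qq2.
have s1 : smeas D (fun t => \1_(`[p, q2[) t *: F t).
  apply: (smeas_lipschitz mu D F p q2 L) => // t t' /andP[h1 h2] /andP[h3 h4].
  by apply: FL; apply/andP; split => //; [exact: lt_trans q2T|exact: lt_trans q2T].
have sf : smeas D f by rewrite fE; exact: smeasZ.
pose C := nm (F p) + L * (q2 - p).
have C0 : 0 <= C by rewrite addr_ge0 ?nm_ge0// mulr_ge0// subr_ge0 ltW.
have FC t : nm (\1_(`[p, q2[) t *: F t) <= C.
  rewrite indicE; have [/set_mem|_] := boolP (t \in _); last by rewrite scale0r nm0.
  rewrite /= in_itv/= scale1r => /andP[pt tq2].
  rewrite -(subrK (F p) (F t)) (le_trans (nmD _ _ _))// addrC lerD2l.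
  rewrite (le_trans (FL _ _ _ _))//.
  - by rewrite pt (lt_trans tq2).
  - by rewrite lexx (lt_trans pq2).
  by rewrite ler_wpM2l// ger0_norm ?subr_ge0// lerD2r ltW.
have inf : lambda.-integrable D (fun t : R => (nm (f t))%:E).
  have i1 : lambda.-integrable D (fun t : R => ((`|derive1 phi t|)%:E * C%:E)%E).
    by apply: integrableZr => //; exact: (integrable_norm iphiD).
  apply: le_integrable i1 => //.
    have mf : measurable_fun D (fun t => nm (f t)) := measurable_smeas_nm mu D f sf.
    exact/measurable_EFinP.
  move=> t Dt; rewrite -EFinM /= lee_fin ger0_norm ?nm_ge0//.
  rewrite (le_trans _ (ler_norm _))// fE nmZ ler_wpM2l//.
have aef : {ae lambda, forall t, D t -> nm (f t - f t) = 0}.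
  by apply: aeW => t _; rewrite subrr nm0.
have := bochner_integral_pairing mu D f f mD sf inf aef psi.
have := Dw phi tphi; rewrite /RL_derivative => /L2_eq0P; rewrite nmN => RL0.
rewrite (ip_eq0l mu _ _ RL0) => /esym I0.
rewrite -[RHS]I0 Rintegral_mkcond [RHS]Rintegral_mkcond.
apply: eq_Rintegral => t _; rewrite !patchE.
have -> : (t \in D) = (0 < t < T).
  by apply/idP/idP => [/set_mem|hs]; [|apply/mem_set]; rewrite /D /= in_itv.
have -> : (t \in `[p, q]%classic) = (p <= t <= q).
  by apply/idP/idP => [/set_mem|hs]; [|apply/mem_set]; rewrite /= in_itv.
have [/andP[pt tq]|ntpq] := boolP (p <= t <= q).
  have at_ : a < t by exact: lt_le_trans pt.
  have tT : t < T by exact: le_lt_trans qT.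
  by rewrite (lt_trans a0 at_) tT/= /f ipZl frac_integral_pairing// at_ tT.
case: ifP => // _; rewrite /f ipZl phi'0 ?mul0r//.
by move: ntpq; rewrite negb_and -!ltNge.
Unshelve. all: by end_near. Qed.

(** H' = 0 for H = K0 M_(alpha-1), whose derivative is K0 (1 - alpha) M_alpha. *)
Lemma memory_vanishes psi t : a < t < T -> mem psi alpha t = 0.
Proof.
have /andP[al0 al1] := alpha01; have a0' := a0; have aT' := aT; have Gp := G0.
move=> tT.
have iu1 := iu_sub psi a (ltW aT).
have dm b s : -1 <= b -> a < s -> is_derive s 1 (mem psi b) (- b * mem psi (b + 1) s).
  by move=> b1 as_; apply: is_derive_memory => //; exact: ltW.
have := @fundamental_lemma R a T (fun s => K0 * mem psi (alpha - 1) s)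
  (fun s => K0 * (- (alpha - 1) * mem psi alpha s)) _ _ (test_integral_zero psi) t tT.
have K00 : K0 != 0.
  by rewrite /K0 invr_eq0 mulf_neq0//; [apply/eqP; lra|rewrite gt_eqF].
move=> H; have /eqP : K0 * (- (alpha - 1) * mem psi alpha t) = 0.
  apply: H.
  - move=> s /andP[as_ sT].
    have := dm (alpha - 1) s; rewrite subrK => /(_ _ as_) d1.
    have {}d1 : is_derive s 1 (mem psi (alpha - 1)) (- (alpha - 1) * mem psi alpha s).
      by apply: d1; lra.
    exact: (@is_deriveZ R R^o R^o _ K0 s 1 _ d1).
  - move=> s /andP[as_ sT].
    have d1 := dm alpha s ltac:(lra) as_.
    have d2 := @is_deriveZ R R^o R^o _ (- (alpha - 1)) s 1 _ d1.
    have d3 := @is_deriveZ R R^o R^o _ K0 s 1 _ d2.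
    exact: (@ex_derive _ _ _ _ _ _ _ d3).
rewrite !mulf_eq0 (negbTE K00)/= => /orP[/eqP|/eqP//]; lra.
Qed.

Lemma pairing_vanishes psi :
  ip h psi = 0 /\ {ae lambda, forall s, 0 < s < a -> ip (wt s) psi = 0}.
Proof.
have /andP[al0 al1] := alpha01; have a0' := a0; have aT' := aT; have Gp := G0.
pose t0 := (a + T) / 2.
have at0 : a < t0 by rewrite /t0; lra.
have t0T : t0 < T by rewrite /t0; lra.
apply: (memory_moments a (ip h psi) alpha t0 (u psi)) => //.
  exact: iu_sub (ltW aT).
move=> j; apply: (memory_zero_all a _ T) => //.
- exact: ltW.
- exact: iu_sub (ltW aT).
- by move=> t; exact: memory_vanishes.
- by rewrite at0.
Qed.

(** A value wt t is a limit of values at t of simple functions s_k, and these are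
combinations of the countably many vectors in the ranges of the s_k.  For
almost every t all these are orthogonal to wt t, so wt t is orthogonal to
itself. *)
Lemma vanishing : {ae lambda, forall s, 0 < s < T -> nm (w s) = 0} /\ nm h = 0.
Proof.
split; last first.
  by apply/eqP; rewrite -sqrf_eq0 nm_sqr (pairing_vanishes h).1.
have [s ss] := swt.
have H : {ae lambda, forall t, forall k i : nat, forall hi : (i < sf_size (s k))%N,
    0 < t < a -> ip (wt t) (sf_val (s := s k) (Ordinal hi)) = 0}.
  apply: ae_foralln => k; apply: ae_foralln => i.
  have [hi|nhi] := pselect (is_true (i < sf_size (s k))%N); last by apply: aeW => t hi'; case: nhi.
  have := (pairing_vanishes (sf_val (s := s k) (Ordinal hi))).2.
  apply: ae_imp => t ht hi'; rewrite (_ : hi' = hi)//; exact: bool_irrelevance.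
apply: (ae_imp2 _ _ _ _ H wwt) => t Ht ww tT.
suff wt_0 : nm (wt t) = 0.
  apply/eqP; rewrite eq_le nm_ge0 andbT -[leRHS]wt_0 -[leRHS]add0r -(ww tT).
  by rewrite -[X in nm X <= _](subrK (wt t)) nmD.
have [ta|at_] := ltP t a; last by rewrite wt0// nm0.
have ta' : 0 < t < a by rewrite ta andbT; case/andP: tT.
apply/eqP; rewrite -sqrf_eq0 nm_sqr; apply/eqP.
have Dt : `]0, T[%classic t by rewrite /= in_itv.
have h1 := ip_cvg mu (fun=> wt t) (fun k => sf_eval (s k) t) (wt t) (wt t).
have h2 : ip (wt t) (sf_eval (s k) t) @[k --> \oo] --> ip (wt t) (wt t).
  by apply: h1; [under eq_fun do rewrite subrr nm0; exact: cvg_cst|exact: ss].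
rewrite (_ : (fun k => _) = (fun=> 0)) in h2.
  by rewrite (cvg_unique _ h2 (cvg_cst 0)).
apply/funext => k; rewrite ipC ip_sf_eval big1// => i _.
rewrite ipC; have := Ht k i (ltn_ord i) ta'.
by rewrite (_ : Ordinal (ltn_ord i) = i) => [->|]; [rewrite mulr0|exact: val_inj].
Qed.

End unique_continuation.

(** * Conclusion *)

(** Reduction to [vanishing]: the auxiliary [wt] is a version of [w] that is zero
after time a and strongly measurable in the everywhere sense. *)
Lemma L2_unique_continuation {d : measure_display} {X : measurableType d}
    {R : realType} (mu : {measure set X -> \bar R}) (alpha a T : R)
    (w : R -> L2 mu) (h : L2 mu) :
  0 < alpha < 1 -> 0 < a -> a < T -> bochner_integrable `]0, T[ w ->
  vanishes_on a T w ->
  distribution_vanishes_on a T (RL_derivative T alpha (fun t => w t - h)) ->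
  vanishes_on 0 T w /\ L2_eq0 h.
Proof.
move=> alpha01 a0 aT [mw iw] w0 Dw.
pose lambda := @lebesgue_measure R.
pose D : set R := `]0, T[%classic.
have mD : measurable D by exact: measurable_itv.
have [N [mN N0 sw]] := strongly_measurable_smeas mu D w mw.
pose wt t := \1_(`]0, a[) t *: (\1_(~` N) t *: w t).
have swt : smeas mu D wt.
  by apply: smeasZ => //; apply: measurable_indic; exact: measurable_itv.
have wt0 t : a <= t -> wt t = 0.
  move=> at_; rewrite /wt indicE memNset ?scale0r//= in_itv/=.
  by apply/negP; rewrite negb_and -!leNgt at_ orbT.
have aeN : {ae lambda, forall t, ~ N t}.
  by exists N; split => // t /= /contrapT.
have aea : {ae lambda, forall t, t != a}.
  exists [set a]; split; [exact: measurable_set1|exact: lebesgue_measure_set1|].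
  by move=> t /= /negP; rewrite negbK => /eqP.
have wwt : {ae lambda, forall t, 0 < t < T -> nm mu (w t - wt t) = 0}.
  apply: (ae_imp2 _ _ _ _ aeN (ae_imp2 _ _ _ (fun t h1 h2 => conj h1 h2) aea w0)).
  move=> t nNt [ta wt_0] /andP[t0 tT].
  have [lta|at_] := ltP t a.
    rewrite /wt !indicE !mem_set ?scale1r ?subrr ?nm0//.
    by rewrite /= in_itv/= t0.
  rewrite wt0// subr0; apply/L2_eq0P/wt_0.
  by rewrite tT andbT lt_neqAle eq_sym ta.
(* The norm of w need not be measurable; that of wt is, and its integral is the same. *)
have iwt : lambda.-integrable D (fun t : R => (nm mu (wt t))%:E).
  apply: integrable_nm => //; apply: le_lt_trans iw; rewrite integral_L2_norm.
  rewrite le_eqVlt; apply/orP; left; apply/eqP.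
  apply: ge0_ae_eq_integral_nonmeasurable.
  - by move=> t _; rewrite lee_fin nm_ge0.
  - by move=> t _; rewrite lee_fin nm_ge0.
  apply: (ae_imp _ _ _ wwt) => t ww; rewrite /D /= in_itv/= => /ww {}ww.
  congr EFin; apply/eqP; rewrite -subr_eq0 -normr_le0.
  by rewrite (le_trans (ler_nmB _ _ _))// nmBC ww.
have [w_0 h0] := vanishing mu alpha a T w wt h alpha01 a0 aT swt iwt wt0 wwt Dw.
split; last exact/L2_eq0P.
by apply: (ae_imp _ _ _ w_0) => t + tT => /(_ tT) /L2_eq0P.
Qed.

Theorem theoremA1 (R : realType) (n : nat) (M : ptopologicalType)
  (SM : smooth_manifold R n M) (g : riemannian_metric SM)
  (compactM : compact [set: M]) (connectedM : connected [set: M])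
  (mu : {measure set (borel_space M) -> \bar R})
  (muX : is_riemannian_volume g mu \/ is_boundary_volume g mu)
  (alpha T eps : R) (alpha01 : 0 < alpha < 1) (T_gt0 : 0 < T)
  (w : R -> L2 mu) (wL1 : bochner_integrable `]0, T[ w) (h : L2 mu)
  (eps0T : 0 < eps < T) :
  vanishes_on (T - eps) T w ->
  distribution_vanishes_on (T - eps) T
    (RL_derivative T alpha (fun t => w t - h)) ->
  vanishes_on 0 T w /\ L2_eq0 h.
Proof.
have /andP[e0 eT] := eps0T.
by apply: L2_unique_continuation; rewrite // ?subr_gt0// ltrBlDr ltrDl.
Qed.
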